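(* Let $b>0$ and $0\le\omega<\pi^2$ be constants and consider the autonomous problem (P). Then every non-negative bounded complete trajectory $\varphi$ of (P) which is neither identically $0$ nor identically equal to $v_1^+$ is of the form: there exists $\tau\in\mathbb{R}$ with $\varphi(t)=0$ for $t\le\tau$ and $\varphi(t)=u(t)$ for $t\ge\tau$, where $u$ is the unique solution on $[\tau,+\infty)$ of $\partial_t u-\partial_{xx}u=b+\omega u$ on $(\tau,\infty)\times(0,1)$, $u(t,0)=u(t,1)=0$, $u(\tau)=0$.
   Context: $H=L^2(0,1)$, $V=H_0^1(0,1)$, $A=-d^2/dx^2$ with $D(A)=H^2(0,1)\cap V$. $H_0(s)=\{-1\}$ for $s<0$, $[-1,1]$ for $s=0$, $\{1\}$ for $s>0$. Problem (P) with initial time $\tau$ and datum $u_\tau\in H$: $\partial_t u-\partial_{xx}u\in bH_0(u)+\omega u$ on $(\tau,\infty)\times(0,1)$, $u(t,0)=u(t,1)=0$, $u(\tau)=u_\tau$. A solution is $u\in C([\tau,\infty),H)$ with $u(\tau)=u_\tau$, absolutely continuous on each $[T_1,T_2]$ with $\tau<T_1<T_2$, $u(t)\in D(A)$ for a.e. $t$, and such that there is $r\in L^2_{loc}(\tau,\infty;H)$ with $r(t)(x)\in bH_0(u(t)(x))+\omega u(t)(x)$ for a.e. $x$, for a.e. $t$, and $du/dt+Au=r$ in $H$ for a.e. $t>\tau$; the linear problem is understood in the same sense with $r=b+\omega u$. A complete trajectory is $\varphi:\mathbb{R}\to H$ such that $\varphi|_{[\tau,\infty)}$ is a solution with initial time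 $\tau$ for every $\tau$; it is bounded if its range is bounded in $H$ and non-negative if $\varphi(t)\ge0$ a.e. for all $t$. $v_1^+$ denotes the positive stationary solution: the unique $v\in H^2(0,1)\cap V$, positive on $(0,1)$, with $-v''=b+\omega v$ on $(0,1)$, $v(0)=v(1)=0$ (viewed as a constant complete trajectory). *)

(* Defs.v *)
From HB Require Import structures.
From mathcomp Require Import all_boot all_order all_algebra.
From mathcomp Require Import all_classical all_reals all_analysis.
Set Implicit Arguments. Unset Strict Implicit. Unset Printing Implicit Defensive.
Import Order.TTheory GRing.Theory Num.Theory.
Import numFieldNormedType.Exports.
Local Open Scope classical_set_scope.
Local Open Scope ring_scope.

Section PDE.
Variable R : realType.
Local Notation mu := (@lebesgue_measure R).

Definition I01 : set R := `[0%R, 1%R].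

Definition normH2 (f : R -> R) : \bar R := (\int[mu]_(x in I01) ((f x) ^+ 2)%:E)%E.

Definition normH (f : R -> R) : R := Num.sqrt (fine (normH2 f)).

Definition eqH (f g : R -> R) : Prop := {ae mu, forall x, x \in I01 -> f x = g x}.

Definition inH (f : R -> R) : Prop :=
  exists g : R -> R, measurable_fun I01 g /\ eqH f g /\ (normH2 g < +oo)%E.

Definition Rint (a b : R) (g : R -> R) : R := fine (\int[mu]_(y in `[a, b]) (g y)%:E)%E.

(* f belongs to D(A) = H^2(0,1) \cap H^1_0(0,1) and g2 represents its second
   derivative f'' (so A f = - g2).  In one dimension H^2(0,1) is the space of
   functions g with g' absolutely continuous and g'' in L^2, i.e.
   g(x) = g(0) + int_0^x g1, g1(x) = g1(0) + int_0^x g2 with g2 in L^2. *)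
Definition inDA_with (f g2 : R -> R) : Prop :=
  inH g2 /\ measurable_fun I01 g2 /\
  exists g g1 : R -> R, eqH f g /\ g 0 = 0 /\ g 1 = 0 /\
    (forall x, 0 <= x <= 1 -> g1 x = g1 0 + Rint 0 x g2) /\
    (forall x, 0 <= x <= 1 -> g x = g 0 + Rint 0 x g1).

Definition H0 (s : R) : set R :=
  [set y | (s < 0 /\ y = -1) \/ (s = 0 /\ -1 <= y <= 1) \/ (0 < s /\ y = 1)].

Definition continuousH_from (tau : R) (u : R -> R -> R) : Prop :=
  forall t, tau <= t -> forall e : R, 0 < e -> exists d : R, 0 < d /\
    forall s, tau <= s -> `|s - t| < d -> (normH2 (fun x => (u s x - u t x)%R) < e%:E)%E.

Definition abs_contH (T1 T2 : R) (u : R -> R -> R) : Prop :=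
  forall e : R, 0 < e -> exists d : R, 0 < d /\
    forall (n : nat) (a b : nat -> R),
      (forall i, (i < n)%N -> T1 <= a i /\ a i <= b i /\ b i <= T2) ->
      (forall i, (i.+1 < n)%N -> b i <= a i.+1) ->
      \sum_(i < n) (b i - a i) < d ->
      \sum_(i < n) normH (fun x => u (b i) x - u (a i) x) < e.

Definition derivH_at (tau : R) (u : R -> R -> R) (t : R) (d : R -> R) : Prop :=
  inH d /\
  forall e : R, 0 < e -> exists de : R, 0 < de /\
    forall h, h != 0 -> `|h| < de -> tau < t + h ->
      (normH2 (fun x => ((u (t + h) x - u t x) / h - d x)%R) < e%:E)%E.

(* r in L^2_loc(tau,oo;H): r(t) in H for every t > tau (given by a measurable
   representative), t |-> r(t) weakly (hence, H being separable, strongly)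
   measurable, and int_{T1}^{T2} |r(t)|^2 dt < oo for tau < T1 < T2. *)
Definition L2locH (tau : R) (r : R -> R -> R) : Prop :=
  (forall t, tau < t -> inH (r t) /\ measurable_fun I01 (r t)) /\
  (forall g : R -> R, measurable_fun I01 g -> inH g ->
     measurable_fun [set t | tau < t]
       (fun t => fine (\int[mu]_(x in I01) (r t x * g x)%:E)%E)) /\
  (forall T1 T2, tau < T1 -> T1 < T2 ->
     (\int[mu]_(t in `[T1, T2]) normH2 (r t) < +oo)%E).

Definition is_solution_with (tau : R) (u0 : R -> R) (u : R -> R -> R)
  (rhs : (R -> R -> R) -> Prop) : Prop :=
  (forall t, tau <= t -> inH (u t)) /\
  continuousH_from tau u /\
  eqH (u tau) u0 /\
  (forall T1 T2, tau < T1 -> T1 < T2 -> abs_contH T1 T2 u) /\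
  exists r : R -> R -> R, L2locH tau r /\ rhs r /\
    {ae mu, forall t, tau < t ->
       exists d g2 : R -> R, inDA_with (u t) g2 /\ derivH_at tau u t d /\
         (* du/dt + A u = r in H, with A u(t) = - g2 *)
         eqH (fun x => d x - g2 x) (r t)}.

Definition is_solution_P (b omega tau : R) (u0 : R -> R) (u : R -> R -> R) : Prop :=
  is_solution_with tau u0 u (fun r =>
    {ae mu, forall t, tau < t ->
      {ae mu, forall x, x \in I01 ->
        exists y, H0 (u t x) y /\ r t x = b * y + omega * u t x}}).

Definition is_solution_lin (b omega tau : R) (u0 : R -> R) (u : R -> R -> R) : Prop :=
  is_solution_with tau u0 u (fun r =>
    {ae mu, forall t, tau < t -> eqH (r t) (fun x => b + omega * u t x)}).

Definition complete_trajectory_P (b omega : R) (phi : R -> R -> R) : Prop :=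
  forall tau : R, is_solution_P b omega tau (phi tau) phi.

Definition boundedH (phi : R -> R -> R) : Prop :=
  exists M : R, forall t, normH (phi t) <= M.

Definition nonnegH (phi : R -> R -> R) : Prop :=
  forall t, {ae mu, forall x, x \in I01 -> 0 <= phi t x}.

Definition is_v1plus (b omega : R) (v : R -> R) : Prop :=
  (forall x, 0 < x < 1 -> 0 < v x) /\ v 0 = 0 /\ v 1 = 0 /\
  exists v1 v2 : R -> R, inH v2 /\ measurable_fun I01 v2 /\
    (forall x, 0 <= x <= 1 -> v1 x = v1 0 + Rint 0 x v2) /\
    (forall x, 0 <= x <= 1 -> v x = v 0 + Rint 0 x v1) /\
    eqH (fun x => - v2 x) (fun x => b + omega * v x).

End PDE.

(* Main.v *)
Require Import Defs.
From HB Require Import structures.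
From mathcomp Require Import all_boot all_order all_algebra.
From mathcomp Require Import all_classical all_reals all_analysis.
From mathcomp Require Import measurable_realfun ring lra.
Set Implicit Arguments. Unset Strict Implicit. Unset Printing Implicit Defensive.
Import Order.TTheory GRing.Theory Num.Theory.
Import numFieldNormedType.Exports.
Local Open Scope classical_set_scope.
Local Open Scope ring_scope.

(* Let u be a nonnegative trajectory.  Where u(t) vanishes, both u_t and u_xx
   vanish almost everywhere, so that u_t - u_xx = b 1_{u > 0} + omega u >= 0: u is
   a supersolution of the heat equation.  Testing it against explicit compactly
   supported subsolutions of the backward heat equation yields the strong maximum
   principle: once u(t0) is not 0, u(t) > 0 almost everywhere for t > t0, and
   from then on u solves the linear equation.  If the infimum tau of the times at
   which u is not 0 is finite, the claim follows, uniqueness being a consequence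
   of the Poincare inequality with a constant between omega and pi^2.  If
   tau = -oo, then u is a bounded solution of the linear equation on the whole
   line, and the same contraction estimate forces u = v_1^+. *)

(** * Absolutely continuous functions *)

(** Two features of the setting shape the proof. A solution is only a curve in L^2 with a derivative
    at almost every time, so no pointwise comparison is available; every estimate is the
    monotonicity of a real function of t, such as A(t) <u(t), psi(t)>, which is absolutely
    continuous and has a derivative of known sign almost everywhere. Moreover b H_0 is multivalued
    at 0, so the equation does not prescribe r where u vanishes; only the vanishing of both
    derivatives there does. The test functions are (rho - (x - xi)^2)_+^3 with explicit rho(t) and
    xi(t). A bump whose centre moves while its radius shrinks carries positive mass to any
    prescribed point. A second one with fixed centre, whose weight is a negative power of rho, is
    sharp enough to turn positive mass into pointwise positivity. The contraction is only needed
    with a linear rate, N(t) (1 + k (t - s)) <= N(s): boundedness on the whole line already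
    contradicts that. *)

(** A form of Cousin's lemma: the supremum of the points reachable from [a] is itself reachable and
    cannot stay below [b]. The local hypothesis only concerns intervals that contain the tag [x],
    which is what differentiability at [x] controls. *)
Lemma interval_induction (R : realType) (a b : R) (P : R -> R -> Prop) :
  a <= b ->
  (forall x y z, a <= x -> x <= y -> y <= z -> z <= b ->
    P x y -> P y z -> P x z) ->
  (forall x, a <= x <= b -> exists2 e, 0 < e &
    forall s t, a <= s -> s <= x -> x <= t -> t <= b -> x - e < s ->
      t < x + e -> P s t) ->
  P a b.
Proof.
move=> ab Ptr Ploc.
pose S := [set x | a <= x <= b /\ P a x].
have Sa : S a.
  split; first by rewrite lexx.
  have [|e e0 H] := Ploc a; first by rewrite lexx.
  by apply: H; rewrite ?lexx//; lra.
have hS : has_sup S by split; [exists a|exists b => x [/andP[]]].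
have aS : a <= sup S by apply: ub_le_sup => //; case: hS.
have Sb : sup S <= b by apply: ge_sup; [exists a|move=> x [/andP[]]].
have [|e e0 H] := Ploc (sup S); first by rewrite aS.
have [x [/andP[ax xb] Pax] xS] := sup_adherent e0 hS.
have xsup : x <= sup S by apply: ub_le_sup; [case: hS|split => //; rewrite ax].
have PaS : P a (sup S).
  by apply: (Ptr _ x) => //; apply: H => //; lra.
have [->//|nb] := eqVneq b (sup S).
have sb : sup S < b by rewrite lt_neqAle eq_sym nb.
pose t := Num.min b (sup S + e / 2).
have st : sup S < t by rewrite /t lt_min sb/=; lra.
have tb : t <= b by rewrite /t ge_min lexx.
have te : t < sup S + e.
  by apply: (@le_lt_trans _ _ (sup S + e / 2)); [rewrite /t ge_min lexx orbT|lra].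
suff : t <= sup S by rewrite leNgt st.
apply: ub_le_sup; [by case: hS|split].
  by rewrite tb andbT (le_trans aS)// ltW.
by apply: (Ptr _ (sup S)) => //; [exact: ltW|apply: H => //; lra].
Qed.

(** Free of division and valid at h = 0, so that estimates on increments need no case
    distinction. *)
Lemma is_derive_eps (R : realType) (F : R -> R) (x D : R) :
  is_derive x 1 F D <->
  forall e, 0 < e -> exists2 d, 0 < d &
    forall h, `|h| < d -> `|F (x + h) - F x - D * h| <= e * `|h|.
Proof.
split=> [[dF <-] e e0|H].
  have : h^-1 *: (F (h *: (1:R) + x) - F x) @[h --> (0:R)^'] --> 'D_1 F x.
    exact: dF.
  move/cvgrPdist_le => /(_ e e0).
  rewrite near_withinE near_simpl /= => /nbhs_ballP[d /= d0 Hd].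
  exists d => // h hd.
  have [->|h0] := eqVneq h 0; first by rewrite addr0 subrr mulr0 subrr normr0 mulr0.
  have := Hd h; rewrite /ball/= sub0r normrN => /(_ hd h0).
  rewrite [_ *: 1]mulr1 [h + x]addrC => H.
  rewrite -ler_pdivrMr ?normr_gt0// -normfV -normrM.
  have -> : (F (x + h) - F x - 'D_1 F x * h) * h^-1 =
     - ('D_1 F x - h^-1 *: (F (x + h) - F x)).
    by rewrite /GRing.scale/=; field.
  by rewrite normrN.
suff : h^-1 *: (F (h *: (1:R) + x) - F x) @[h --> (0:R)^'] --> D.
  move=> c; have dF : derivable F x 1 by apply/cvg_ex; exists D.
  by split => //; apply/cvg_lim.
apply/cvgrPdist_le => e e0.
have [d d0 Hd] := H e e0.
rewrite near_withinE near_simpl /=; apply/nbhs_ballP; exists d => //= h.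
rewrite /ball/= sub0r normrN => hd h0.
rewrite [_ *: 1]mulr1 [h + x]addrC.
have -> : D - h^-1 *: (F (x + h) - F x) =
     - ((F (x + h) - F x - D * h) * h^-1).
  by rewrite /GRing.scale/=; field.
by rewrite normrN normrM normfV ler_pdivrMr ?normr_gt0// Hd.
Qed.

Section AbsoluteContinuity.
Variable R : realType.
Local Notation mu := (@lebesgue_measure R).

(** Ordered non-overlapping intervals as a list rather than an indexed family: gluing two of them in
    an interval induction is then concatenation. *)
Fixpoint chain (s : R) (l : seq (R * R)) (t : R) : Prop :=
  if l is p :: l' then [/\ s <= p.1, p.1 <= p.2 & chain p.2 l' t] else s <= t.

Lemma chain_le s l t : chain s l t -> s <= t.
Proof.
elim: l s => [//|p l IH] s [/= sp pp /IH pt].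
exact/(le_trans sp)/(le_trans pp).
Qed.

Lemma chain_weak s s' l t : s <= s' -> chain s' l t -> chain s l t.
Proof.
case: l => [|p l] ss' /=; first exact: le_trans.
by case=> sp pp c; split => //; exact: le_trans sp.
Qed.

Lemma chain_cat s l1 t l2 r : chain s l1 t -> chain t l2 r ->
  chain s (l1 ++ l2) r.
Proof.
elim: l1 s => [|p l IH] s /=; first exact: chain_weak.
by case=> sp pp c1 c2; split => //; exact: IH.
Qed.

Definition abs_contR (T1 T2 : R) (F : R -> R) : Prop :=
  forall e : R, 0 < e -> exists2 d : R, 0 < d &
    forall l, chain T1 l T2 -> \sum_(p <- l) (p.2 - p.1) < d ->
      \sum_(p <- l) `|F p.2 - F p.1| < e.

(* Cousin's argument: away from an open set of small measure containing the
   exceptional null set, the derivative controls the increments; inside it,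
   absolute continuity does. *)
Lemma abs_cont_nondecreasing (T1 T2 : R) (F : R -> R) : T1 <= T2 ->
  abs_contR T1 T2 F ->
  {ae mu, forall t, T1 <= t <= T2 -> exists2 D, 0 <= D & is_derive t 1 F D} ->
  F T1 <= F T2.
Proof.
move=> T12 acF [A [mA A0 HA]].
(* The part e (T2 - T1) pays for the points of differentiability, the additional e for the intervals
   inside the open set [U]. *)
suff H e : 0 < e -> F T1 <= F T2 + e * (T2 - T1 + 1).
  apply/ler_addgt0Pr => e e0.
  have T0 : 0 < T2 - T1 + 1 by lra.
  by have := H _ (divr_gt0 e0 T0); rewrite divfK// gt_eqF.
move=> e0; have [d d0 Hd] := acF e e0.
have [|U [oU AU UA]] := @lebesgue_regularity_outer _ A d mA _ d0.
  by rewrite [ltLHS]A0 ltry.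
have mU : measurable U by exact: open_measurable.
have muU : (mu U < d%:E)%E.
  rewrite -(setDUK AU) (measureU mu) //; last 2 first.
  - exact: measurableD.
  - by rewrite setDE setICA setICr setI0.
  by rewrite [X in (X + _)%E]A0 add0e.
(* Half-open, so that the pieces of adjacent intervals are disjoint and their measures add up. *)
pose M s t : set R := U `&` `[s, t[.
have mM s t : measurable (M s t) by apply: measurableI.
(* The list records the intervals lying in [U]. Their total length is at most the measure of [U], so
   absolute continuity bounds the total increment over them; elsewhere F loses at most e per unit of
   length. *)
pose P s t := exists l, [/\ chain s l t,
  F s <= F t + e * (t - s) + \sum_(p <- l) `|F p.2 - F p.1| &
  ((\sum_(p <- l) (p.2 - p.1))%:E <= mu (M s t))%E].
have [l [cl Fl ll]] : P T1 T2; last first.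
  have : ((\sum_(p <- l) (p.2 - p.1))%:E < d%:E)%E.
    apply: (le_lt_trans ll); apply: le_lt_trans muU.
    by apply: le_measure; [rewrite inE; exact: mM|rewrite inE; exact: mU|exact: subIsetl].
  rewrite lte_fin => /(Hd _ cl) se.
  by apply: (le_trans Fl); lra.
apply: interval_induction => //.
  move=> x y z ax xy yz zb [l [cl Fl ll]] [k [ck Fk kk]].
  exists (l ++ k); split; first exact: chain_cat ck.
    by rewrite big_cat/=; lra.
  rewrite big_cat/= EFinD.
  have -> : M x z = M x y `|` M y z.
    rewrite /M -setIUr; congr (_ `&` _).
    by rewrite -itv_bndbnd_setU// bnd_simp.
  rewrite (measureU mu); [exact: leeD|exact: mM|exact: mM|].
  apply/seteqP; split => // w [[_ /=]]; rewrite in_itv/= => /andP[_ wy] [_ /=].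
  by rewrite in_itv/= leNgt wy.
move=> x xT; have [Ux|nUx] := pselect (U x).
  have [d' /= d'0 bU] : \forall r \near x, U r by exact: oU.
  exists d' => // s t T1s sx xt tT2 xs tx.
  exists [:: (s, t)]; split => /=.
  - by split => //; exact: le_trans sx xt.
  - rewrite big_seq1/=; have := ler_norm (F s - F t); rewrite distrC.
    have : 0 <= e * (t - s) by apply: mulr_ge0; lra.
    lra.
  - rewrite big_seq1/= /M (_ : U `&` _ = `[s, t[%classic).
      by rewrite lebesgue_measure_itv/= lte_fin; case: ltP => //= ts; rewrite lee_fin; lra.
    apply/setIidPr => w; rewrite /= in_itv/= => /andP[sw wt].
    by apply: bU; rewrite /= ltr_distlC; lra.
have [D D0 /is_derive_eps /(_ e e0)[d' d'0 H]] : exists2 D, 0 <= D & is_derive x 1 F D.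
  move: xT; apply: contrapT => /not_implyP[xT nD].
  by apply/nUx/AU/HA => /= /(_ xT).
exists d' => // s t T1s sx xt tT2 xs tx.
exists [::]; split => /=; first exact: le_trans sx xt.
  rewrite big_nil addr0.
  have := H (s - x); have := H (t - x).
  have -> : x + (t - x) = t by lra.
  have -> : x + (s - x) = s by lra.
  rewrite ger0_norm ?subr_ge0// (ler0_norm (x := s - x)) ?subr_le0//.
  move=> /(_ ltac:(lra)); rewrite ler_norml => /andP[H1 _].
  move=> /(_ ltac:(lra)); rewrite ler_norml => /andP[_ H2].
  have : 0 <= D * (t - x) by apply: mulr_ge0; lra.
  have : 0 <= D * (x - s) by apply: mulr_ge0; lra.
  lra.
by rewrite big_nil measure_ge0.
Qed.

End AbsoluteContinuity.

(** * The space L^2(0, 1) *)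

Import HBNNSimple.

(** Neither function is assumed measurable, because [normH2] is applied to arbitrary representatives
    of elements of H. The integral being a supremum over simple functions below the integrand, it
    suffices to set such a simple function to zero on the exceptional null set. *)
Lemma ge0_integral_ae_eq (d : measure_display) (T : measurableType d)
    (R : realType) (m : {measure set T -> \bar R}) (D : set T)
    (f g : T -> \bar R) :
  (forall x, D x -> 0 <= f x)%E -> (forall x, D x -> 0 <= g x)%E ->
  {ae m, forall x, D x -> f x = g x} ->
  (\int[m]_(x in D) f x = \int[m]_(x in D) g x)%E.
Proof.
move=> f0 g0 fg.
suff H (u v : T -> \bar R) : (forall x, D x -> 0 <= u x)%E ->
    (forall x, D x -> 0 <= v x)%E -> {ae m, forall x, D x -> u x = v x} ->
    (\int[m]_(x in D) u x <= \int[m]_(x in D) v x)%E.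
  apply/eqP; rewrite eq_le !H//.
  by apply: filterS fg => x + Dx => ->.
move=> u0 v0 [N [mN N0 HN]].
rewrite !ge0_integralE//.
apply: ge_ereal_sup => _ [h hu <-].
have mC : measurable (~` N) by exact: measurableC.
apply: ereal_sup_ubound; exists (proj_nnsfun h mC).
  move=> x /=; have hx := hu x.
  rewrite /= mindicE; have [xN|xN] := boolP (x \in ~` N); last first.
    rewrite mulr0 patchE; case: ifPn => // /set_mem Dx; exact: v0.
  rewrite mulr1 (le_trans hx)// !patchE; case: ifPn => // /set_mem Dx.
  suff -> : u x = v x by [].
  apply: contrapT => uv; move/set_mem: xN; apply; apply: HN => /=.
  by apply/not_implyP; split.
rewrite -!integralT_nnsfun.
rewrite [RHS](@ge0_negligible_integral _ _ _ m setT N)//; last 2 first.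
- exact/measurable_EFinP.
- by move=> x _; rewrite lee_fin fun_ge0.
rewrite setTD [RHS]integral_mkcond; apply: eq_integral => x _ /=.
by rewrite patchE mindicE; case: ifPn => _; rewrite ?mulr1 ?mulr0.
Qed.

Section L2.
Variable R : realType.
Local Notation mu := (@lebesgue_measure R).
Local Notation I := (@I01 R).
Implicit Types f g h : R -> R.

Lemma measurable_I01 : measurable I.
Proof. exact: measurable_itv. Qed.

Lemma mu_I01 : mu I = 1%E.
Proof. by rewrite /I01 lebesgue_measure_itv/= lte_fin ltr01 oppr0 adde0. Qed.

Lemma in_I01 (x : R) : (x \in I) = (0 <= x <= 1).
Proof.
by apply/idP/idP; rewrite inE /I01/= in_itv.
Qed.

Lemma I01E (x : R) : I x = (0 <= x <= 1).
Proof. by rewrite /I01/= in_itv. Qed.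

Lemma aeS (P Q : R -> Prop) : (forall x, P x -> Q x) ->
  {ae mu, forall x, P x} -> {ae mu, forall x, Q x}.
Proof. by move=> PQ; apply: (@filterS _ _ (ae_filter_ringOfSetsType mu)). Qed.

Lemma aeS2 (P Q S : R -> Prop) : (forall x, P x -> Q x -> S x) ->
  {ae mu, forall x, P x} -> {ae mu, forall x, Q x} -> {ae mu, forall x, S x}.
Proof. by move=> PQ; apply: (@filterS2 _ _ (ae_filter_ringOfSetsType mu)). Qed.

Lemma eqH_sym f g : eqH f g -> eqH g f.
Proof. by apply: aeS => x + xI => ->. Qed.

Lemma eqH_trans f g h : eqH f g -> eqH g h -> eqH f h.
Proof. by apply: aeS2 => x + + xI => -> // ->. Qed.

Lemma normH2_eqH f g : eqH f g -> normH2 f = normH2 g.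
Proof.
move=> fg; apply: ge0_integral_ae_eq.
- by move=> x _; rewrite lee_fin sqr_ge0.
- by move=> x _; rewrite lee_fin sqr_ge0.
- by apply: aeS fg => x + Ix => ->//; rewrite inE.
Qed.

Definition L2 f := measurable_fun I f /\ (normH2 f < +oo)%E.

Definition ip f g := \int[mu]_(x in I) (f x * g x).

Lemma ip_eqH f f' g g' : L2 f -> L2 f' -> L2 g -> L2 g' ->
  eqH f f' -> eqH g g' -> ip f g = ip f' g'.
Proof.
move=> [mf _] [mf' _] [mg _] [mg' _] ff' gg'.
rewrite /ip /Rintegral; congr fine; apply: ae_eq_integral.
- exact: measurable_I01.
- by apply/measurable_EFinP; exact: measurable_funM.
- by apply/measurable_EFinP; exact: measurable_funM.
- apply: aeS2 ff' gg' => x + + Ix; have xI : x \in I by rewrite inE.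
  by move=> /(_ xI) -> /(_ xI) ->.
Qed.

Lemma L2_int_sqr f : L2 f -> mu.-integrable I (EFin \o (fun x => f x ^+ 2)).
Proof.
case=> mf fi; apply/integrableP; split.
  by apply/measurable_EFinP; exact: measurable_funX.
rewrite (_ : (fun x => _) = (fun x => (f x ^+ 2)%:E))//.
by apply/funext => x /=; rewrite ger0_norm ?sqr_ge0.
Qed.

Lemma int_sqr_L2 f : measurable_fun I f ->
  mu.-integrable I (EFin \o (fun x => f x ^+ 2)) -> L2 f.
Proof.
move=> mf /integrableP[_]; split => //.
apply: le_lt_trans b; rewrite /normH2 le_eqVlt; apply/orP; left; apply/eqP.
by apply: eq_integral => x _ /=; rewrite ger0_norm ?sqr_ge0.
Qed.

Lemma L2_mul_int f g : L2 f -> L2 g ->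
  mu.-integrable I (EFin \o (fun x => f x * g x)).
Proof.
move=> Lf Lg.
apply: (@le_integrable _ _ _ mu I measurable_I01 _
  (fun x => ((f x ^+ 2)%R%:E + (g x ^+ 2)%R%:E)%E)).
- apply/measurable_EFinP; apply: measurable_funM; [by case: Lf|by case: Lg].
- move=> x _ /=; rewrite lee_fin.
  rewrite (ger0_norm (addr_ge0 (sqr_ge0 _) (sqr_ge0 _))) ler_norml.
  have := sqr_ge0 (f x + g x); have := sqr_ge0 (f x - g x).
  have := sqr_ge0 (f x); have := sqr_ge0 (g x); rewrite !expr2 => *.
  by apply/andP; split; nra.
- by apply: integrableD; [exact: measurable_I01|exact: L2_int_sqr|exact: L2_int_sqr].
Qed.

Lemma L2_scale (k : R) f : L2 f -> L2 (fun x => k * f x).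
Proof.
move=> Lf; apply: int_sqr_L2.
  by apply: measurable_funM => //; case: Lf.
apply: (@eq_integrable _ _ _ mu I measurable_I01
  (fun x => ((k ^+ 2)%R%:E * (f x ^+ 2)%R%:E)%E)).
  by move=> x _ /=; rewrite -EFinM exprMn.
by apply: integrableZl; [exact: measurable_I01|exact: L2_int_sqr].
Qed.

Lemma L2_add f g : L2 f -> L2 g -> L2 (fun x => f x + g x).
Proof.
move=> Lf Lg; apply: int_sqr_L2.
  by apply: measurable_funD; [case: Lf|case: Lg].
apply: (@eq_integrable _ _ _ mu I measurable_I01
  (fun x => ((f x ^+ 2)%R%:E +
    ((g x ^+ 2)%R%:E + (2%R%:E * (f x * g x)%R%:E)))%E)).
  by move=> x _ /=; rewrite -EFinM -!EFinD; congr EFin; ring.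
have mI := measurable_I01.
apply: integrableD => //; first exact: L2_int_sqr.
apply: integrableD => //; first exact: L2_int_sqr.
by apply: integrableZl => //; exact: L2_mul_int.
Qed.

Lemma L2_sub f g : L2 f -> L2 g -> L2 (fun x => f x - g x).
Proof.
move=> Lf Lg; have := L2_add Lf (L2_scale (-1) Lg).
by rewrite (_ : (fun x => _) = (fun x => f x - g x))//; apply/funext => x; rewrite mulN1r.
Qed.

Lemma bounded_on_I01 f (C : R) : (forall x, I x -> `|f x| <= C) ->
  [bounded f x | x in I].
Proof.
move=> fC; exists C; split; first exact: num_real.
by move=> M CM x Ix; exact/(le_trans (fC x Ix))/ltW.
Qed.

Lemma bounded_L2 f (C : R) : measurable_fun I f ->
  (forall x, I x -> `|f x| <= C) -> L2 f.
Proof.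
move=> mf fC; apply: int_sqr_L2 => //.
apply: measurable_bounded_integrable.
- exact: measurable_I01.
- by rewrite [ltLHS]mu_I01 ltry.
- exact: measurable_funX.
- apply: (@bounded_on_I01 _ (C ^+ 2)) => x Ix.
  by rewrite normrX; apply: lerXn2r; rewrite ?nnegrE// ?fC// (le_trans _ (fC x Ix)).
Qed.

Lemma L2_bounded_mul f h (C : R) : L2 f -> measurable_fun I h ->
  (forall x, I x -> `|h x| <= C) -> L2 (fun x => h x * f x).
Proof.
move=> Lf mh hC; have [mf _] := Lf; apply: int_sqr_L2.
  exact: measurable_funM.
apply: (@le_integrable _ _ _ mu I measurable_I01 _
  (EFin \o (fun x => (C * f x) ^+ 2))).
- by apply/measurable_EFinP; apply: measurable_funX; exact: measurable_funM.
- move=> x Ix /=; rewrite lee_fin !ger0_norm ?sqr_ge0//.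
  rewrite !exprMn ler_wpM2r ?sqr_ge0// -[h x ^+ 2]real_normK ?num_real//.
  by rewrite ler_sqr ?nnegrE ?hC// (le_trans _ (hC x Ix)).
- by apply: L2_int_sqr; exact: L2_scale.
Qed.

Lemma ipC f g : ip f g = ip g f.
Proof. by apply: eq_Rintegral => x _; rewrite mulrC. Qed.

Lemma ip_addl f g h : L2 f -> L2 g -> L2 h ->
  ip (fun x => f x + g x) h = ip f h + ip g h.
Proof.
move=> Lf Lg Lh; rewrite /ip -RintegralD; last 3 first.
- exact: measurable_I01.
- exact: L2_mul_int.
- exact: L2_mul_int.
by apply: eq_Rintegral => x _; rewrite mulrDl.
Qed.

Lemma ip_scalel k f h : L2 f -> L2 h -> ip (fun x => k * f x) h = k * ip f h.
Proof.
move=> Lf Lh; rewrite /ip -RintegralZl.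
- by apply: eq_Rintegral => x _; rewrite mulrA.
- exact: measurable_I01.
- exact: L2_mul_int.
Qed.

Lemma ip_subl f g h : L2 f -> L2 g -> L2 h ->
  ip (fun x => f x - g x) h = ip f h - ip g h.
Proof.
move=> Lf Lg Lh; rewrite /ip -RintegralB; last 3 first.
- exact: measurable_I01.
- exact: L2_mul_int.
- exact: L2_mul_int.
by apply: eq_Rintegral => x _; rewrite mulrBl.
Qed.

Lemma ip_addr f g h : L2 f -> L2 g -> L2 h ->
  ip h (fun x => f x + g x) = ip h f + ip h g.
Proof. by move=> *; rewrite !(ipC h) ip_addl. Qed.

Lemma ip_scaler k f h : L2 f -> L2 h -> ip h (fun x => k * f x) = k * ip h f.
Proof. by move=> *; rewrite !(ipC h) ip_scalel. Qed.

Lemma ip_subr f g h : L2 f -> L2 g -> L2 h ->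
  ip h (fun x => f x - g x) = ip h f - ip h g.
Proof. by move=> *; rewrite !(ipC h) ip_subl. Qed.

Lemma ip_ge0 f : 0 <= ip f f.
Proof. by apply: Rintegral_ge0 => x _; rewrite -expr2 sqr_ge0. Qed.

Lemma ip_ae_le f g h : L2 f -> L2 g -> L2 h ->
  (forall x, I x -> 0 <= h x) ->
  {ae mu, forall x, x \in I -> f x <= g x} -> ip f h <= ip g h.
Proof.
move=> Lf Lg Lh h0 fg; rewrite -subr_ge0 -ip_subl//.
have Ld := L2_sub Lg Lf.
(* The inequality holds only almost everywhere; replacing g - f by its absolute value changes it on
   a null set and makes the integrand nonnegative everywhere. *)
have La : L2 (fun x => `|g x - f x|).
  case: Ld => md di; split; first exact: measurableT_comp.
  by rewrite /normH2; under eq_integral do rewrite real_normK ?num_real//.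
rewrite (@ip_eqH _ (fun x => `|g x - f x|) _ h)//.
- apply: Rintegral_ge0 => x Ix; apply: mulr_ge0 => //; exact: h0.
- by apply: aeS fg => x + xI => /(_ xI) fgx; rewrite ger0_norm// subr_ge0.
- exact: aeW.
Qed.

Lemma normH2E f : L2 f -> normH2 f = (ip f f)%:E.
Proof.
move=> Lf; rewrite /ip /Rintegral; under eq_integral do rewrite -expr2.
exact: (esym (fineK (@integrable_fin_num _ _ _ mu _ measurable_I01 _ (L2_int_sqr Lf)))).
Qed.

Lemma normHE f : L2 f -> normH f = Num.sqrt (ip f f).
Proof. by move=> Lf; rewrite /normH normH2E. Qed.

Lemma normH_ge0 f : 0 <= normH f.
Proof. exact: sqrtr_ge0. Qed.

Lemma normH_sqr f : L2 f -> normH f ^+ 2 = ip f f.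
Proof. by move=> Lf; rewrite normHE// sqr_sqrtr// ip_ge0. Qed.

Lemma normH_eqH f g : eqH f g -> normH f = normH g.
Proof. by move=> fg; rewrite /normH (normH2_eqH fg). Qed.

Lemma cauchy_schwarz f g : L2 f -> L2 g -> ip f g ^+ 2 <= ip f f * ip g g.
Proof.
move=> Lf Lg.
have H (t s : R) : 0 <= t ^+ 2 * ip f f + t * s * ip f g *+ 2 + s ^+ 2 * ip g g.
  have Lt := L2_scale t Lf; have Ls := L2_scale s Lg.
  have := ip_ge0 (fun x => t * f x + s * g x).
  rewrite ip_addl ?ip_addr ?ip_scalel ?ip_scaler//; try exact: L2_add.
  by rewrite (ipC g f); congr (0 <= _); ring.
have fg := ip_ge0 f; have gg := ip_ge0 g.
have [g0|g0] := eqVneq (ip g g) 0.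
  have [f0|f0] := eqVneq (ip f f) 0.
    have := H 1 1; have := H 1 (-1); rewrite f0 g0 => *.
    have -> : ip f g = 0 by lra.
    by rewrite expr0n mulr0.
  have := H (- ip f g) (ip f f); rewrite g0 !mulr0 addr0.
  have : 0 < ip f f by rewrite lt_neqAle eq_sym f0.
  move=> f1; rewrite !expr2 mulr2n => K.
  have : ip f f * (ip f g * ip f g) <= 0 by nra.
  by rewrite pmulr_rle0.
have g1 : 0 < ip g g by rewrite lt_neqAle eq_sym g0.
have := H (ip g g) (- ip f g); rewrite !expr2 mulr2n => K.
have : ip g g * (ip f g * ip f g) <= ip g g * (ip f f * ip g g) by nra.
by rewrite ler_pM2l.
Qed.

Lemma ip_norm_le f g : L2 f -> L2 g -> `|ip f g| <= normH f * normH g.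
Proof.
move=> Lf Lg; rewrite -ler_sqr ?nnegrE ?mulr_ge0 ?normH_ge0//.
by rewrite exprMn !normH_sqr// real_normK ?num_real// cauchy_schwarz.
Qed.

Lemma normH_add f g : L2 f -> L2 g ->
  normH (fun x => f x + g x) <= normH f + normH g.
Proof.
move=> Lf Lg; rewrite -ler_sqr ?nnegrE ?addr_ge0 ?normH_ge0//.
rewrite normH_sqr; last exact: L2_add.
rewrite ip_addl ?ip_addr//; last exact: L2_add.
have := ip_norm_le Lf Lg; rewrite ler_norml => /andP[_ K].
by rewrite (ipC g f) -(normH_sqr Lf) -(normH_sqr Lg); nra.
Qed.

Lemma normH_scale k f : L2 f -> normH (fun x => k * f x) = `|k| * normH f.
Proof.
move=> Lf; have Lk := L2_scale k Lf.
rewrite !normHE// ip_scalel ?ip_scaler// mulrA -expr2 sqrtrM ?sqr_ge0//.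
by rewrite sqrtr_sqr.
Qed.

Lemma normH_subC f g : normH (fun x => f x - g x) = normH (fun x => g x - f x).
Proof.
rewrite /normH /normH2; congr (Num.sqrt (fine _)).
by apply: eq_integral => x _; rewrite -sqrrN opprB.
Qed.

Lemma normH_bound f (C : R) : 0 <= C -> L2 f ->
  (forall x, I x -> `|f x| <= C) -> normH f <= C.
Proof.
move=> C0 Lf fC; rewrite -ler_sqr ?nnegrE ?normH_ge0// normH_sqr//.
have -> : C ^+ 2 = \int[mu]_(x in I) (C ^+ 2).
  by rewrite Rintegral_cst ?[X in fine X]mu_I01 ?mulr1//; exact: measurable_I01.
apply: le_Rintegral.
- exact: measurable_I01.
- exact: L2_mul_int.
- apply: measurable_bounded_integrable.
  + exact: measurable_I01.
  + by rewrite [ltLHS]mu_I01 ltry.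
  + exact: measurable_cst.
  + by apply: (@bounded_on_I01 _ (C ^+ 2)) => x _; rewrite ger0_norm ?sqr_ge0.
- move=> x Ix; rewrite -expr2 -[f x ^+ 2]real_normK ?num_real//.
  by rewrite ler_sqr ?nnegrE// fC.
Qed.

Lemma ip0_eqH f h : L2 f -> L2 h -> (forall x, I x -> 0 <= f x * h x) ->
  ip f h = 0 -> {ae mu, forall x, x \in I -> f x * h x = 0}.
Proof.
move=> Lf Lh fh0 i0.
have mfh : measurable_fun I (EFin \o (fun x => f x * h x)).
  by apply/measurable_EFinP; apply: measurable_funM; [case: Lf|case: Lh].
have /(ae_eq_integral_abs mu measurable_I01 mfh) :
    (\int[mu]_(x in I) `|(EFin \o (fun x => (f x * h x)%R)) x| = 0)%E.
  under eq_integral => x xI.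
    rewrite /= ger0_norm; last by apply: fh0; exact/set_mem.
    over.
  rewrite -[LHS]fineK; first by congr EFin.
  exact: (@integrable_fin_num _ _ _ mu _ measurable_I01 _ (L2_mul_int Lf Lh)).
by apply: aeS => x + xI => /(_ (set_mem xI)) [].
Qed.

Lemma normH0_eqH f : L2 f -> ip f f = 0 -> eqH f (fun _ => 0).
Proof.
move=> Lf /(ip0_eqH Lf Lf) H; have := H _.
move=> /(_ ltac:(by move=> x _; rewrite -expr2 sqr_ge0)).
by apply: aeS => x + xI => /(_ xI) /eqP; rewrite mulf_eq0 orbb => /eqP.
Qed.

Lemma inH_L2 f : inH f -> exists2 g, L2 g & eqH f g.
Proof. by move=> [g [mg [fg gi]]]; exists g. Qed.

End L2.

(** * Primitives of square integrable functions *)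

Section Primitive.
Variable R : realType.
Local Notation mu := (@lebesgue_measure R).
Local Notation I := (@I01 R).
Local Notation Rint := (@Defs.Rint R).
Implicit Types f g h k : R -> R.

Lemma L2_cst (c : R) : L2 (fun _ : R => c).
Proof. by apply: (@bounded_L2 _ _ `|c|) => //; exact: measurable_cst. Qed.

Lemma L2_indic (x y : R) : L2 (\1_(`[x, y]%classic) : R -> R).
Proof.
apply: (@bounded_L2 _ _ 1).
  by apply: measurable_indic; exact: measurable_itv.
by move=> z _; rewrite indicE; case: (_ \in _); rewrite ?normr1 ?normr0.
Qed.

Lemma itv_sub_I01 (x y : R) : 0 <= x -> y <= 1 -> `[x, y]%classic `<=` I.
Proof.
move=> x0 y1 z; rewrite I01E /= in_itv/= => /andP[xz zy].
by rewrite (le_trans x0)// (le_trans zy).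
Qed.

Lemma RintE (x y : R) h : 0 <= x -> y <= 1 ->
  Rint x y h = ip h (\1_(`[x, y]%classic)).
Proof.
move=> x0 y1; rewrite /ip.
have -> : Rint x y h = \int[mu]_(z in I `&` `[x, y]) h z.
  by rewrite setIidr//; exact: itv_sub_I01.
rewrite Rintegral_mkcondr; apply: eq_Rintegral => z _.
by rewrite patchE indicE; case: ifPn => _; rewrite ?mulr1 ?mulr0.
Qed.

Lemma L2_integrable h : L2 h -> mu.-integrable I (EFin \o h).
Proof.
move=> Lh; apply: (@eq_integrable _ _ _ mu I (@measurable_I01 R)
  (EFin \o (fun x => h x * 1))).
  by move=> x _ /=; rewrite mulr1.
by apply: L2_mul_int => //; exact: L2_cst.
Qed.

Lemma L2_integrable_itv h (x y : R) : L2 h -> 0 <= x -> y <= 1 ->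
  mu.-integrable `[x, y] (EFin \o h).
Proof.
move=> Lh x0 y1; apply: integrableS (L2_integrable Lh).
- exact: measurable_I01.
- exact: measurable_itv.
- exact: itv_sub_I01.
Qed.

Lemma Rint_cst (c x y : R) : x <= y -> Rint x y (fun _ => c) = c * (y - x).
Proof.
move=> xy; have H : mu `[x, y]%classic = (y - x)%:E.
  rewrite lebesgue_measure_itv/= lte_fin; case: ltP => //= yx.
  by congr EFin; lra.
rewrite -[LHS]/(\int[mu]_(z in `[x, y]) c) Rintegral_cst; last exact: measurable_itv.
by rewrite [X in fine X]H.
Qed.

Lemma Rint_add (x y : R) f g : 0 <= x -> y <= 1 -> L2 f -> L2 g ->
  Rint x y (fun z => f z + g z) = Rint x y f + Rint x y g.
Proof. by move=> *; rewrite !RintE// ip_addl//; exact: L2_indic. Qed.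

Lemma Rint_sub (x y : R) f g : 0 <= x -> y <= 1 -> L2 f -> L2 g ->
  Rint x y (fun z => f z - g z) = Rint x y f - Rint x y g.
Proof. by move=> *; rewrite !RintE// ip_subl//; exact: L2_indic. Qed.

Lemma Rint_scale (x y c : R) f : 0 <= x -> y <= 1 -> L2 f ->
  Rint x y (fun z => c * f z) = c * Rint x y f.
Proof. by move=> *; rewrite !RintE// ip_scalel//; exact: L2_indic. Qed.

Lemma Rint_eq (x y : R) f g : (forall z : R, x <= z <= y -> f z = g z) ->
  Rint x y f = Rint x y g.
Proof.
move=> fg; apply: eq_Rintegral => z; rewrite inE/= in_itv/=; exact: fg.
Qed.

Lemma Rint_chasles (x y z : R) h : 0 <= x -> x <= y -> y <= z -> z <= 1 ->
  L2 h -> Rint x z h = Rint x y h + Rint y z h.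
Proof.
move=> x0 xy yz z1 Lh.
have xz := le_trans xy yz.
have ixz := L2_integrable_itv Lh x0 z1.
have iyz := L2_integrable_itv Lh (le_trans x0 xy) z1.
have := @Rintegral_itvB _ h (BLeft x) (BRight z) y ixz.
rewrite !bnd_simp => /(_ xy yz).
rewrite Rintegral_itv_obnd_cbnd; last first.
  apply: integrableS iyz; [exact: measurable_itv|exact: measurable_itv|].
  by apply: subset_itvr; rewrite bnd_simp.
by rewrite -[LHS]/(Rint x z h - Rint x y h) -[RHS]/(Rint y z h); lra.
Qed.

Lemma Rint_le_bound (x y M : R) f : 0 <= x -> x <= y -> y <= 1 -> L2 f ->
  (forall z : R, x <= z <= y -> `|f z| <= M) -> `|Rint x y f| <= M * (y - x).
Proof.
move=> x0 xy y1 Lf fM; rewrite -(Rint_cst M xy).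
have fi := L2_integrable_itv Lf x0 y1.
apply: (le_trans (le_normr_Rintegral _ fi)); first exact: measurable_itv.
apply: le_Rintegral; [exact: measurable_itv|exact: integrable_norm| |].
  exact: (L2_integrable_itv (L2_cst M) x0 y1).
by move=> z; rewrite /= in_itv/=; exact: fM.
Qed.

(** Cauchy-Schwarz against an indicator; primitives of L^2 functions are thus Hölder continuous of
    exponent 1/2. *)
Lemma Rint_normH (x y : R) h : 0 <= x -> x <= y -> y <= 1 -> L2 h ->
  `|Rint x y h| <= Num.sqrt (y - x) * normH h.
Proof.
move=> x0 xy y1 Lh; rewrite RintE// mulrC.
have Li := L2_indic x y.
apply: (le_trans (ip_norm_le Lh Li)); rewrite ler_wpM2l ?normH_ge0//.
rewrite normHE// -RintE//.
rewrite (@Rint_eq _ _ _ (fun _ => 1)) ?Rint_cst ?mul1r// => z xzy.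
by rewrite indicE mem_set//= in_itv.
Qed.

(** Membership of f in H^1(0,1), with its continuous representative and a chosen representative of
    the derivative. *)
Definition prim f h := L2 h /\
  forall x : R, 0 <= x <= 1 -> f x = f 0 + Rint 0 x h.

Lemma prim_incr f h (x y : R) : prim f h -> 0 <= x -> x <= y -> y <= 1 ->
  f y - f x = Rint x y h.
Proof.
move=> [Lh fE] x0 xy y1.
rewrite (fE y) ?(fE x) ?(le_trans x0 xy) ?x0 ?(le_trans xy y1)//.
by rewrite (@Rint_chasles 0 x y)//; lra.
Qed.

Lemma prim_measurable f h : prim f h -> measurable_fun I f.
Proof.
move=> [Lh fE].
have c := @parameterized_integral_continuous _ 0 1 h ler01 (L2_integrable Lh).
have : measurable_fun I (fun x => Rint 0 x h).
  by apply: subspace_continuous_measurable_fun => //; exact: measurable_I01.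
move=> m; apply: (@eq_measurable_fun _ _ _ _ _ (fun x => f 0 + Rint 0 x h)).
  by move=> x; rewrite inE I01E => x01; rewrite [RHS]fE.
by apply: measurable_funD => //; exact: measurable_cst.
Qed.

Lemma prim_bounded f h : prim f h ->
  exists C : R, forall x, I x -> `|f x| <= C.
Proof.
move=> [Lh fE]; exists (`|f 0| + normH h) => x; rewrite I01E => x01.
have /andP[x0 x1] := x01.
rewrite fE// (le_trans (ler_normD _ _))// lerD2l.
rewrite (le_trans (Rint_normH _ _ _ Lh))// ler_piMl ?normH_ge0//.
by rewrite -[leRHS]sqrtr1 ler_wsqrtr// subr0.
Qed.

Lemma prim_L2 f h : prim f h -> L2 f.
Proof.
move=> pf; have [C fC] := prim_bounded pf.
exact: bounded_L2 (prim_measurable pf) fC.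
Qed.

Lemma prim_ext f g h k : prim f h -> (forall x : R, 0 <= x <= 1 -> f x = g x) ->
  (forall x : R, 0 <= x <= 1 -> h x = k x) -> L2 k -> prim g k.
Proof.
move=> [Lh fE] fg hk Lk; split => // x x01.
rewrite -!fg// ?lexx ?ler01// fE//; congr (_ + _); apply: Rint_eq => z /andP[z0 zx].
by apply: hk; rewrite z0/= (le_trans zx)//; case/andP: x01.
Qed.

Lemma prim_sub f g h k : prim f h -> prim g k ->
  prim (fun x => f x - g x) (fun x => h x - k x).
Proof.
move=> [Lh fE] [Lk gE]; split; first exact: L2_sub.
move=> x x01; rewrite fE// gE// Rint_sub//; last by case/andP: x01.
by ring.
Qed.

(** The error f t - f s - int_s^t h is additive over adjacent intervals, so a local bound by e (t -
    s) propagates by interval induction. *)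
Lemma prim_of_local f h : L2 h ->
  (forall e x : R, 0 < e -> 0 <= x <= 1 -> exists2 d : R, 0 < d & forall s t : R,
     0 <= s -> s <= x -> x <= t -> t <= 1 -> x - d < s -> t < x + d ->
     `|f t - f s - Rint s t h| <= e * (t - s)) ->
  prim f h.
Proof.
move=> Lh H; split => // y /andP[y0 y1].
suff K e : 0 < e -> `|f y - f 0 - Rint 0 y h| <= e.
  apply/eqP; rewrite -subr_eq0 opprD addrA -normr_le0; apply/ler_addgt0Pr => e e0.
  by rewrite add0r K.
move=> e0; apply: (@le_trans _ _ (e * (y - 0))); last first.
  by rewrite subr0 ler_piMr// ltW.
apply: (@interval_induction _ 0 y (fun s t => `|f t - f s - Rint s t h| <= e * (t - s))) => //.
  move=> a b c a0 ab bc cy Pab Pbc.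
  have c1 := le_trans cy y1.
  rewrite (@Rint_chasles a b c)//.
  have -> : f c - f a - (Rint a b h + Rint b c h) =
    (f b - f a - Rint a b h) + (f c - f b - Rint b c h) by ring.
  by rewrite (le_trans (ler_normD _ _))//; lra.
move=> x /andP[x0 xy]; have [|d d0 K] := H e x e0; first by rewrite x0 (le_trans xy).
by exists d => // s t *; apply: K => //; exact: le_trans y1.
Qed.

(* With [h] bounded and [k] square integrable the error of the product rule on
   [s, t] is of order (t - s)^(3/2). *)
Lemma prim_mul f g h k (C : R) : prim f h -> prim g k ->
  (forall x, I x -> `|h x| <= C) ->
  prim (fun x => f x * g x) (fun x => h x * g x + f x * k x).
Proof.
move=> pf pg hC.
have [Lh _] := pf; have [Lk _] := pg.
have mf := prim_measurable pf; have mg := prim_measurable pg.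
have Lf := prim_L2 pf; have Lg := prim_L2 pg.
have [Bf fB] := prim_bounded pf; have [Bg gB] := prim_bounded pg.
have Lhg : L2 (fun x => h x * g x).
  by apply: (@L2_bounded_mul _ _ _ C) => //; case: Lh.
have Lfk : L2 (fun x => f x * k x) by apply: (@L2_bounded_mul _ _ _ Bf).
have C0 : 0 <= C by rewrite (le_trans _ (hC 0 _))// I01E lexx ler01.
apply: prim_of_local; first exact: L2_add.
move=> e x e0 /andP[x0 x1].
(* Each of the three error terms below is at most C |k| (t - s)^(3/2); the added 1 keeps [K]
   positive. *)
pose K := 3 * C * normH k + 1.
have K0 : 0 < K by rewrite /K ltr_wpDl// ?mulr_ge0 ?normH_ge0.
(* An interval within this distance on both sides of x has length below (e / K)^2, whence K (t -
   s)^(1/2) <= e. *)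
exists ((e / K) ^+ 2 / 2); first by rewrite divr_gt0// exprn_gt0// divr_gt0.
move=> s t s0 sx xt t1 xs tx.
have st := le_trans sx xt.
pose r := Num.sqrt (t - s).
have r0 : 0 <= r by exact: sqrtr_ge0.
have rK : K * r <= e.
  rewrite mulrC -ler_pdivlMr//.
  have -> : e / K = Num.sqrt ((e / K) ^+ 2).
    by rewrite sqrtr_sqr ger0_norm// divr_ge0// ltW.
  by rewrite ler_wsqrtr//; lra.
have Df z : s <= z <= t -> `|f z - f s| <= C * (t - s).
  move=> /andP[sz zt]; have z1 := le_trans zt t1; have z0 := le_trans s0 sz.
  rewrite (prim_incr pf)//.
  apply: (@le_trans _ _ (C * (z - s))); last by rewrite ler_wpM2l//; lra.
  apply: Rint_le_bound => // w /andP[sw wz]; apply: hC.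
  by rewrite I01E (le_trans s0 sw) (le_trans wz z1).
have Dg z : s <= z <= t -> `|g z - g s| <= r * normH k.
  move=> /andP[sz zt]; have z1 := le_trans zt t1; have z0 := le_trans s0 sz.
  rewrite (prim_incr pg)// (le_trans (Rint_normH _ _ _ Lk))//.
  by rewrite ler_wpM2r ?normH_ge0// ler_wsqrtr//; lra.
have Lhs : L2 (fun z => g s * h z) by exact: L2_scale.
have Lks : L2 (fun z => f s * k z) by exact: L2_scale.
have Lfs : L2 (fun z => f z - f s) by apply: L2_sub => //; exact: L2_cst.
have Lgs : L2 (fun z => g z - g s) by apply: L2_sub => //; exact: L2_cst.
have La : L2 (fun z => h z * (g z - g s)).
  by apply: (@L2_bounded_mul _ _ _ C) => //; case: Lh.
have Lb : L2 (fun z => (f z - f s) * k z).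
  apply: (@L2_bounded_mul _ _ _ (Bf + Bf)) => //; first by case: Lfs.
  move=> z Iz; rewrite (le_trans (ler_normB _ _))// lerD ?fB//.
  by rewrite I01E s0 (le_trans st).
have -> : Rint s t (fun z => h z * g z + f z * k z) =
    g s * (f t - f s) + Rint s t (fun z => h z * (g z - g s)) +
    (f s * (g t - g s) + Rint s t (fun z => (f z - f s) * k z)).
  rewrite Rint_add// (prim_incr pf)// (prim_incr pg)//.
  rewrite -!Rint_scale// -!Rint_add//; try exact: L2_add.
  by apply: Rint_eq => z _; ring.
have -> : f t * g t - f s * g s - (g s * (f t - f s) +
      Rint s t (fun z => h z * (g z - g s)) +
      (f s * (g t - g s) + Rint s t (fun z => (f z - f s) * k z))) =
   (f t - f s) * (g t - g s) - Rint s t (fun z => h z * (g z - g s)) -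
     Rint s t (fun z => (f z - f s) * k z) by ring.
have ts0 : 0 <= t - s by lra.
have B1 : `|(f t - f s) * (g t - g s)| <= C * (t - s) * (r * normH k).
  by rewrite normrM ler_pM// ?Df ?Dg// st lexx.
have B2 : `|Rint s t (fun z => h z * (g z - g s))| <= C * (r * normH k) * (t - s).
  apply: Rint_le_bound => // z szt; rewrite normrM ler_pM// ?Dg//.
  case/andP: szt => sz zt; apply: hC; rewrite I01E.
  by rewrite (le_trans s0 sz) (le_trans zt t1).
have B3 : `|Rint s t (fun z => (f z - f s) * k z)| <= C * (t - s) * (r * normH k).
  have Lnk : L2 (fun z => `|k z|).
    case: Lk => mk ki; split; first exact: measurableT_comp.
    by rewrite /normH2; under eq_integral do rewrite real_normK ?num_real//.
  have -> : normH k = normH (fun z => `|k z|).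
    rewrite /normH /normH2; congr (Num.sqrt (fine _)).
    by apply: eq_integral => z _; rewrite real_normK ?num_real.
  apply: (@le_trans _ _ (Rint s t (fun z => C * (t - s) * `|k z|))).
    have bi := L2_integrable_itv Lb s0 t1.
    apply: (le_trans (le_normr_Rintegral _ bi)); first exact: measurable_itv.
    apply: le_Rintegral; [exact: measurable_itv|exact: integrable_norm| |].
      exact: (L2_integrable_itv (L2_scale _ Lnk)).
    by move=> z; rewrite /= in_itv/= => szt; rewrite normrM ler_wpM2r// Df.
  rewrite Rint_scale// ler_wpM2l ?mulr_ge0//.
  exact: (le_trans (ler_norm _) (Rint_normH _ _ _ Lnk)).
apply: (@le_trans _ _ (K * r * (t - s))); last by rewrite ler_wpM2r.
apply: (@le_trans _ _ (3 * C * normH k * r * (t - s))).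
  by rewrite (le_trans (ler_normB _ _))// (le_trans (lerD (ler_normB _ _) (lexx _)))//; lra.
by rewrite ler_wpM2r// ler_wpM2r// /K lerDl.
Qed.

Lemma C1_prim f h :
  (forall x : R, 0 <= x <= 1 -> is_derive x 1 f (h x)) ->
  (forall x : R, 0 <= x <= 1 -> {for x, continuous h}) -> prim f h.
Proof.
move=> fh ch.
have wh : {within I, continuous h}.
  by apply: continuous_in_subspaceT => x; rewrite in_I01; exact: ch.
have mh : measurable_fun I h.
  by apply: subspace_continuous_measurable_fun => //; exact: measurable_I01.
have Lh : L2 h.
  apply: int_sqr_L2 => //.
  apply: continuous_compact_integrable; first exact: segment_compact.
  apply: continuous_in_subspaceT => x; rewrite in_I01 => x01.
  by apply: (@continuousM _ _ h h x); exact: ch.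
apply: prim_of_local => // e x e0 x01.
have e20 : 0 < e / 2 by lra.
have /is_derive_eps/(_ _ e20)[d1 d10 H1] := fh x x01.
have /cvgrPdist_le/(_ _ e20)/nbhs_ballP[d2 /= d20 H2] : h z @[z --> x] --> h x by exact: ch.
exists (Num.min d1 d2); first by rewrite lt_min d10.
move=> s t s0 sx xt t1 xs tx; have st := le_trans sx xt.
have m1 : Num.min d1 d2 <= d1 by rewrite ge_min lexx.
have m2 : Num.min d1 d2 <= d2 by rewrite ge_min lexx orbT.
have := H1 (t - x); have := H1 (s - x).
have -> : x + (t - x) = t by lra.
have -> : x + (s - x) = s by lra.
rewrite (ger0_norm (x := t - x)) ?subr_ge0// (ler0_norm (x := s - x)) ?subr_le0//.
move=> /(_ ltac:(lra)) K1 /(_ ltac:(lra)) K2.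
have K3 : `|Rint s t (fun z => h z - h x)| <= e / 2 * (t - s).
  apply: Rint_le_bound => //; first by apply: L2_sub => //; exact: L2_cst.
  move=> z /andP[sz zt]; rewrite distrC; apply: H2.
  by rewrite /ball/= ltr_distlC; lra.
rewrite Rint_sub// ?Rint_cst// in K3; last exact: L2_cst.
move: K1 K2 K3; rewrite !ler_norml => /andP[? ?] /andP[? ?] /andP[? ?].
by apply/andP; split; lra.
Qed.

End Primitive.

(** * Derivatives vanish almost everywhere on the zero set *)

Section ZeroSet.
Variable R : realType.
Local Notation mu := (@lebesgue_measure R).
Local Notation I := (@I01 R).
Implicit Types f g h k : R -> R.

(** The isolated points of any set are countable: each is the only point of Z between two rationals,
    and [A] collects these points by pairs of rationals. *)
Lemma isolated_zeros_null (Z : set R) :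
  {ae mu, forall x : R, Z x -> ~ exists2 d : R, 0 < d &
    forall y, y != x -> `|y - x| < d -> ~ Z y}.
Proof.
pose A (pq : rat * rat) := [set x | Z x /\ ratr pq.1 < x < ratr pq.2 /\
  forall y, ratr pq.1 < y < ratr pq.2 -> Z y -> y = x].
have cA : countable (\bigcup_(pq in [set: rat * rat]) A pq).
  apply: bigcup_countable => // pq _.
  have [[x Ax]|nA] := pselect (exists x, A pq x).
    apply: (@sub_countable _ _ _ [set x]); last exact: countable1.
    apply: subset_card_le => y [Zy [ypq _]].
    by case: Ax => _ [_ /(_ y ypq Zy)].
  rewrite (_ : A pq = set0) ?countable0//; apply/seteqP; split => // x Ax.
  by apply: nA; exists x.
exists (\bigcup_(pq in [set: rat * rat]) A pq); split.
- exact: countable_measurable.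
- exact: countable_lebesgue_measure0.
- move=> x /= /not_implyP[Zx /contrapT[d d0 H]].
  have [p] : exists p, ratr p \in `]x - d, x[.
    by apply: rat_in_itvoo; rewrite ltrBlDr ltrDl.
  rewrite in_itv/= => /andP[p1 p2].
  have [q] : exists q, ratr q \in `]x, x + d[.
    by apply: rat_in_itvoo; rewrite ltrDl.
  rewrite in_itv/= => /andP[q1 q2].
  exists (p, q) => //; split => //=; split; first by rewrite p2.
  move=> y /andP[py yq] Zy; apply: contrapT => /eqP yx.
  by apply: (H y yx) => //; rewrite ltr_distl; lra.
Qed.

Lemma ae_interior : {ae mu, forall x : R, x \in I -> 0 < x < 1}.
Proof.
have H (a : R) : {ae mu, forall x : R, x != a}.
  exists [set a]; split; [exact: measurable_set1|exact: lebesgue_measure_set1|].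
  by move=> x /= /negP; rewrite negbK => /eqP.
apply: aeS2 (H 0) (H 1) => x x0 x1; rewrite in_I01 => /andP[x0' x1'].
by rewrite !lt_neqAle eq_sym x0 x0' x1.
Qed.

(** At almost every point f has derivative h, by Lebesgue differentiation. A zero with nonzero
    derivative is isolated, and isolated zeros form a null set. *)
Lemma prim_zero f h : prim f h ->
  {ae mu, forall x : R, x \in I -> f x = 0 -> h x = 0}.
Proof.
move=> pf; have [Lh fE] := pf.
(* Extended by zero, since [FTC1] is applied to a function integrable on the whole line. *)
pose k := h \_ I.
have ik : mu.-integrable setT (EFin \o k).
  have [H _] := @integrable_mkcond _ _ _ mu I (EFin \o h) (@measurable_I01 R).
  by rewrite -restrict_EFin; apply: H; exact: L2_integrable.
have li : locally_integrable [set: R] k.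
  by apply: open_integrable_locally => //; exact: openT.
have iy y : mu.-integrable [set` Interval (BLeft (0:R)) (BRight y)] (EFin \o k).
  by apply: integrableS ik => //; exact: measurable_itv.
have H1 := FTC1 iy li.
have H2 := isolated_zeros_null [set x | 0 <= x <= 1 /\ f x = 0].
have H12 := aeS2 (fun x a b => conj a b) H1 H2.
apply: aeS2 H12 ae_interior => x [K1 K2] xint xI fx0.
have /andP[xp xl] := xint xI.
have x0' := ltW xp; have x1' := ltW xl.
apply: contrapT => /eqP hx0; apply: (K2 _); first by split => //; rewrite x0' x1'.
have [|dF F'] := K1; first by rewrite /= lte_fin.
have kx : k x = h x by rewrite /k patchE mem_set// I01E x0' x1'.
have /is_derive_eps : is_derive x 1
    (fun y : R => \int[mu]_(t in [set` Interval (BLeft (0:R)) (BRight y)]) k t) (h x).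
  by split => //; rewrite -kx -F' derive1E.
have e0 : 0 < `|h x| / 2 by rewrite divr_gt0// normr_gt0.
move=> /(_ _ e0)[d d0 Hd].
exists (Num.min d (Num.min x (1 - x))); first by rewrite !lt_min d0 xp subr_gt0.
move=> y yx; rewrite !lt_min => /andP[yd /andP[ya yb]] [/andP[y0 y1] fy0].
have E z : 0 <= z <= 1 ->
    \int[mu]_(t in [set` Interval (BLeft (0:R)) (BRight z)]) k t = f z - f 0.
  move=> z01; rewrite (fE z z01) addrAC subrr add0r.
  apply: Rint_eq => t /andP[t0 tz]; rewrite /k patchE mem_set// I01E t0.
  by rewrite (le_trans tz)//; case/andP: z01.
have := Hd (y - x) yd.
have -> : x + (y - x) = y by lra.
rewrite !E ?y0 ?x0'// fy0 fx0 subrr sub0r normrN normrM.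
have : 0 < `|y - x| by rewrite normr_gt0 subr_eq0.
have : 0 < `|h x| by rewrite normr_gt0.
by nra.
Qed.

End ZeroSet.

(** * Curves in L^2(0, 1) *)

Section Curves.
Variable R : realType.
Implicit Types (u z : R -> R -> R) (F G : R -> R).

Lemma chain_mem (s t : R) l p : chain s l t -> p \in l ->
  [/\ s <= p.1, p.1 <= p.2 & p.2 <= t].
Proof.
elim: l s => [//|q l IH] s [sq qq c].
rewrite inE => /orP[/eqP ->|/(IH _ c)[qp pp pt]].
  by split => //; exact: chain_le c.
by split => //; exact/(le_trans sq)/(le_trans qq).
Qed.

Lemma chain_nth (s t : R) l x0 i : chain s l t -> (i.+1 < size l)%N ->
  (nth x0 l i).2 <= (nth x0 l i.+1).1.
Proof.
elim: l s i => [//|q l IH] s [|i] [sq qq c] il /=; last by apply: (IH q.2).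
by case: l c il {IH} => [//|p l] [].
Qed.

Definition acH (T1 T2 : R) u := forall e : R, 0 < e -> exists2 d : R, 0 < d &
  forall l, chain T1 l T2 -> \sum_(p <- l) (p.2 - p.1) < d ->
    \sum_(p <- l) normH (fun x => u p.2 x - u p.1 x) < e.

Lemma abs_contH_acH T1 T2 u : abs_contH T1 T2 u -> acH T1 T2 u.
Proof.
move=> H e e0; have [d [d0 Hd]] := H e e0; exists d => // l cl.
have := Hd (size l) (fun i => (nth (0, 0) l i).1) (fun i => (nth (0, 0) l i).2).
rewrite !(big_nth (0, 0)) !big_mkord; apply.
  by move=> i il; have [] := chain_mem cl (mem_nth (0, 0) il).
by move=> i il; exact: chain_nth cl il.
Qed.

Lemma lipschitz_acH T1 T2 u (C : R) : 0 <= C ->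
  (forall s t, T1 <= s -> s <= t -> t <= T2 ->
    normH (fun x => u t x - u s x) <= C * (t - s)) -> acH T1 T2 u.
Proof.
move=> C0 H e e0; exists (e / (C + 1)); first by rewrite divr_gt0// ltr_wpDl.
move=> l cl; rewrite ltr_pdivlMr ?ltr_wpDl// => ld; apply: le_lt_trans ld.
rewrite big_distrl/= big_seq [leRHS]big_seq; apply: ler_sum => p pl.
have [p1 p2 p3] := chain_mem cl pl.
by rewrite (le_trans (H _ _ _ _ _))// mulrC ler_wpM2l ?subr_ge0// lerDl.
Qed.

Lemma lipschitz_abs_contR (T1 T2 : R) F (C : R) : 0 <= C ->
  (forall s t, T1 <= s -> s <= t -> t <= T2 -> `|F t - F s| <= C * (t - s)) ->
  abs_contR T1 T2 F.
Proof.
move=> C0 H e e0; exists (e / (C + 1)); first by rewrite divr_gt0// ltr_wpDl.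
move=> l cl; rewrite ltr_pdivlMr ?ltr_wpDl// => ld; apply: le_lt_trans ld.
rewrite big_distrl/= big_seq [leRHS]big_seq; apply: ler_sum => p pl.
have [p1 p2 p3] := chain_mem cl pl.
by rewrite (le_trans (H _ _ _ _ _))// mulrC ler_wpM2l ?subr_ge0// lerDl.
Qed.

(** The common pattern behind products, inner products and linear combinations of absolutely
    continuous functions. *)
Lemma abs_contR_dominated (T1 T2 M : R) F (a b : R * R -> R) :
  (forall e, 0 < e -> exists2 d : R, 0 < d & forall l, chain T1 l T2 ->
     \sum_(p <- l) (p.2 - p.1) < d -> \sum_(p <- l) a p < e) ->
  (forall e, 0 < e -> exists2 d : R, 0 < d & forall l, chain T1 l T2 ->
     \sum_(p <- l) (p.2 - p.1) < d -> \sum_(p <- l) b p < e) ->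
  0 <= M ->
  (forall p, T1 <= p.1 -> p.1 <= p.2 -> p.2 <= T2 ->
     `|F p.2 - F p.1| <= M * (a p + b p)) ->
  abs_contR T1 T2 F.
Proof.
move=> Ha Hb M0 H e e0.
(* Then 2 M e' = e M / (M + 1) is strictly below e, also when M = 0. *)
pose e' := e / (2 * (M + 1)).
have e'0 : 0 < e' by rewrite divr_gt0// mulr_gt0// ltr_wpDl.
have [d1 d10 H1] := Ha _ e'0; have [d2 d20 H2] := Hb _ e'0.
exists (Num.min d1 d2); first by rewrite lt_min d10.
move=> l cl; rewrite lt_min => /andP[/(H1 _ cl) l1 /(H2 _ cl) l2].
apply: (@le_lt_trans _ _ (M * (\sum_(p <- l) a p + \sum_(p <- l) b p))).
  rewrite -big_split/= big_distrr/= big_seq [leRHS]big_seq.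
  by apply: ler_sum => p pl; have [p1 p2 p3] := chain_mem cl pl; exact: H.
apply: (@le_lt_trans _ _ (M * (e' + e'))).
  by rewrite ler_wpM2l// lerD// ltW.
have -> : M * (e' + e') = e * (M / (M + 1)).
  by rewrite /e'; field; rewrite gt_eqF// ltr_wpDl.
by rewrite gtr_pMr// ltr_pdivrMr ?mul1r ?ltrDl// ltr_wpDl.
Qed.

Lemma abs_contR_mul (T1 T2 M : R) F G :
  abs_contR T1 T2 F -> abs_contR T1 T2 G -> 0 <= M ->
  (forall t, T1 <= t <= T2 -> `|F t| <= M /\ `|G t| <= M) ->
  abs_contR T1 T2 (fun t => F t * G t).
Proof.
move=> HF HG M0 B; apply: (abs_contR_dominated HF HG M0) => -[s t] /= T1s st tT2.
have -> : F t * G t - F s * G s = (F t - F s) * G t + F s * (G t - G s) by ring.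
rewrite (le_trans (ler_normD _ _))// !normrM mulrDr lerD//.
  by rewrite mulrC ler_wpM2r//; case: (B t) => //; rewrite tT2 (le_trans T1s).
by rewrite ler_wpM2r//; case: (B s) => //; rewrite T1s (le_trans st).
Qed.

(** Near each time the norm grows by at most 1, and bounds on adjacent intervals combine, so
    interval induction applies. *)
Lemma acH_bounded (T1 T2 : R) u : T1 <= T2 ->
  (forall t, T1 <= t <= T2 -> L2 (u t)) -> acH T1 T2 u ->
  exists2 M : R, 0 <= M & forall t, T1 <= t <= T2 -> normH (u t) <= M.
Proof.
move=> T12 Lu ac.
apply: (@interval_induction _ T1 T2 (fun s t => exists2 M : R, 0 <= M &
  forall r, s <= r <= t -> normH (u r) <= M)) => //.
  move=> x y z _ xy yz _ [M M0 HM] [N N0 HN].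
  exists (M + N); first exact: addr_ge0.
  move=> r /andP[xr rz]; have [ry|yr] := leP r y.
    by rewrite (le_trans (HM r _)) ?xr// lerDl.
  by have := HN r; rewrite rz ltW// => /(_ isT); lra.
move=> x xT; have [d d0 Hd] := ac 1 ltr01.
exists d => // s t T1s sx xt tT2 xs tx.
exists (normH (u x) + 1); first by rewrite addr_ge0// normH_ge0.
move=> r /andP[sr rt].
have rT : T1 <= r <= T2 by rewrite (le_trans T1s)// (le_trans rt).
suff : normH (fun y => u r y - u x y) < 1.
  move=> H; have -> : u r = (fun y => u x y + (u r y - u x y)).
    by apply/funext => y; rewrite addrC subrK.
  rewrite (le_trans (normH_add (Lu x xT) _))//; first by apply: L2_sub; exact: Lu.
  by rewrite lerD2l ltW.
have /andP[? ?] := xT; have /andP[? ?] := rT.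
have [rx|xr] := leP r x.
  have := Hd [:: (r, x)]; rewrite !big_seq1/= normH_subC; apply => //; lra.
have := Hd [:: (x, r)]; rewrite !big_seq1/=; apply; last lra.
by split => //; exact: ltW.
Qed.

Lemma ip_abs_contR (T1 T2 : R) u z : T1 <= T2 ->
  (forall t, T1 <= t <= T2 -> L2 (u t)) -> acH T1 T2 u ->
  (forall t, T1 <= t <= T2 -> L2 (z t)) -> acH T1 T2 z ->
  abs_contR T1 T2 (fun t => ip (u t) (z t)).
Proof.
move=> T12 Lu au Lz az.
have [M M0 HM] := acH_bounded T12 Lu au; have [N N0 HN] := acH_bounded T12 Lz az.
apply: (@abs_contR_dominated _ _ (M + N) _ _ _ au az); first exact: addr_ge0.
move=> -[s t] /= T1s st tT2.
have sT : T1 <= s <= T2 by rewrite T1s (le_trans st).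
have tT : T1 <= t <= T2 by rewrite tT2 (le_trans T1s).
have Lus := Lu s sT; have Lut := Lu t tT; have Lzs := Lz s sT; have Lzt := Lz t tT.
have Ldu := L2_sub Lut Lus; have Ldz := L2_sub Lzt Lzs.
have -> : ip (u t) (z t) - ip (u s) (z s) =
    ip (fun x => u t x - u s x) (z t) + ip (u s) (fun x => z t x - z s x).
  by rewrite ip_subl// ip_subr//; ring.
rewrite (le_trans (ler_normD _ _))// mulrDr lerD//.
  rewrite (le_trans (ip_norm_le Ldu Lzt))// mulrC ler_wpM2r ?normH_ge0//.
  by rewrite (le_trans (HN t tT))// lerDr.
rewrite (le_trans (ip_norm_le Lus Ldz))// ler_wpM2r ?normH_ge0//.
by rewrite (le_trans (HM s sT))// lerDl.
Qed.

Lemma acH_sub (T1 T2 : R) u z :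
  (forall t, T1 <= t <= T2 -> L2 (u t)) -> acH T1 T2 u ->
  (forall t, T1 <= t <= T2 -> L2 (z t)) -> acH T1 T2 z ->
  acH T1 T2 (fun t x => u t x - z t x).
Proof.
move=> Lu au Lz az e e0; have e20 : 0 < e / 2 by lra.
have [d1 d10 H1] := au _ e20; have [d2 d20 H2] := az _ e20.
exists (Num.min d1 d2); first by rewrite lt_min d10.
move=> l cl; rewrite lt_min => /andP[/(H1 _ cl) l1 /(H2 _ cl) l2].
apply: (@le_lt_trans _ _ (\sum_(p <- l) normH (fun x => u p.2 x - u p.1 x) +
  \sum_(p <- l) normH (fun x => z p.2 x - z p.1 x))); last by lra.
rewrite -big_split/= big_seq [leRHS]big_seq; apply: ler_sum => -[s t] pl.
have [/= p1 p2 p3] := chain_mem cl pl.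
have sT : T1 <= s <= T2 by rewrite p1 (le_trans p2).
have tT : T1 <= t <= T2 by rewrite p3 (le_trans p1).
have Ldu := L2_sub (Lu t tT) (Lu s sT); have Ldz := L2_sub (Lz s sT) (Lz t tT).
rewrite (normH_subC (z t)); apply: le_trans (normH_add Ldu Ldz).
by rewrite le_eqVlt; apply/orP; left; apply/eqP; congr normH; apply/funext => x; ring.
Qed.

(** The analogue of [is_derive_eps] for the L^2 norm. *)
Definition derivL2 u (t : R) (d : R -> R) := L2 d /\
  forall e : R, 0 < e -> exists2 de : R, 0 < de & forall h : R, `|h| < de ->
    normH (fun x => u (t + h) x - u t x - h * d x) <= e * `|h|.

Lemma derivL2_sub (tau t : R) u z d d' : tau < t ->
  (forall s, tau < s -> L2 (u s)) -> (forall s, tau < s -> L2 (z s)) ->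
  derivL2 u t d -> derivL2 z t d' ->
  derivL2 (fun t x => u t x - z t x) t (fun x => d x - d' x).
Proof.
move=> taut Lu Lz [Ld Hd] [Ld' Hd']; split; first exact: L2_sub.
move=> e e0; have e20 : 0 < e / 2 by lra.
have [d1 d10 H1] := Hd _ e20; have [d2 d20 H2] := Hd' _ e20.
exists (Num.min (t - tau) (Num.min d1 d2)).
  by rewrite !lt_min d10 subr_gt0 taut.
move=> h; rewrite !lt_min => /andP[ht /andP[/H1 K1 /H2 K2]].
have th : tau < t + h by move: ht; rewrite ltr_norml => /andP[]; lra.
have Lw v w : (forall s, tau < s -> L2 (v s)) -> L2 w ->
    L2 (fun x => v (t + h) x - v t x - h * w x).
  move=> Lv L; apply: L2_sub; last exact: L2_scale.
  by apply: L2_sub; exact: Lv.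
have L1 := Lw _ _ Lu Ld; have L3 := L2_scale (-1) (Lw _ _ Lz Ld').
have := normH_add L1 L3; rewrite normH_scale; last exact: Lw.
rewrite normrN1 mul1r => K.
have E : (fun x => u (t + h) x - z (t + h) x - (u t x - z t x) - h * (d x - d' x)) =
  (fun x => u (t + h) x - u t x - h * d x + -1 * (z (t + h) x - z t x - h * d' x)).
  by apply/funext => x; ring.
by rewrite E (le_trans K)//; lra.
Qed.

Lemma derivL2_continuous u (t : R) d (tau : R) : tau < t ->
  (forall s, tau < s -> L2 (u s)) -> derivL2 u t d ->
  forall e : R, 0 < e -> exists2 de : R, 0 < de & forall h : R, `|h| < de ->
    normH (fun x => u (t + h) x - u t x) <= e.
Proof.
move=> taut Lu [Ld Hd] e e0; have [d1 d10 H1] := Hd 1 ltr01.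
have n0 : 0 < normH d + 1 by rewrite ltr_wpDl// normH_ge0.
exists (Num.min (t - tau) (Num.min d1 (e / (normH d + 1)))).
  by rewrite !lt_min d10 subr_gt0 taut divr_gt0.
move=> h; rewrite !lt_min => /andP[ht /andP[/H1 K1 he]].
have th : tau < t + h by move: ht; rewrite ltr_norml => /andP[]; lra.
have Ldu := L2_sub (Lu _ th) (Lu _ taut); have Lhd := L2_scale h Ld.
have -> : (fun x => u (t + h) x - u t x) =
    (fun x => (u (t + h) x - u t x - h * d x) + h * d x).
  by apply/funext => x; rewrite subrK.
rewrite (le_trans (normH_add (L2_sub Ldu Lhd) Lhd))// normH_scale//.
by move: he; rewrite ltr_pdivlMr//; nra.
Qed.

Lemma ip_is_derive (tau t : R) u z d d' : tau < t ->
  (forall s, tau < s -> L2 (u s)) -> (forall s, tau < s -> L2 (z s)) ->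
  derivL2 u t d -> derivL2 z t d' ->
  is_derive t 1 (fun s => ip (u s) (z s)) (ip d (z t) + ip (u t) d').
Proof.
move=> taut Lu Lz du dz; apply/is_derive_eps => e e0.
have [Ld Hd] := du; have [Ld' Hd'] := dz.
(* Dominates the second factor in each of the three error terms, z(t + h) included since it is
   within 1 of z(t). Each term is then at most e |h| / 3. *)
pose N := normH (u t) + normH (z t) + normH d + 1 + 1.
have N0 : 0 < N by rewrite /N ltr_wpDl// !addr_ge0// normH_ge0.
have eN : 0 < e / (3 * N) by rewrite divr_gt0// mulr_gt0.
have eN' : 0 < Num.min 1 (e / (3 * N)) by rewrite lt_min ltr01.
have [d1 d10 H1] := Hd _ eN; have [d2 d20 H2] := Hd' _ eN.
have [d3 d30 H3] := derivL2_continuous taut Lz dz eN'.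
exists (Num.min (t - tau) (Num.min d1 (Num.min d2 d3))).
  by rewrite !lt_min d10 d20 d30 subr_gt0 taut.
move=> h; rewrite !lt_min => /andP[ht /andP[/H1 K1 /andP[/H2 K2 /H3]]].
rewrite le_min => /andP[K3 K3'].
have th : tau < t + h by move: ht; rewrite ltr_norml => /andP[]; lra.
have Lut := Lu _ taut; have Luh := Lu _ th; have Lzt := Lz _ taut; have Lzh := Lz _ th.
have Lhd := L2_scale h Ld; have Lhd' := L2_scale h Ld'.
have Ldu := L2_sub Luh Lut; have Ldz := L2_sub Lzh Lzt.
have Lru := L2_sub Ldu Lhd; have Lrz := L2_sub Ldz Lhd'.
have -> : ip (u (t + h)) (z (t + h)) - ip (u t) (z t) -
      (ip d (z t) + ip (u t) d') * h =
    ip (fun x => u (t + h) x - u t x - h * d x) (z (t + h)) +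
    h * ip d (fun x => z (t + h) x - z t x) +
    ip (u t) (fun x => z (t + h) x - z t x - h * d' x).
  rewrite (ip_subl Ldu Lhd)// (ip_subl Luh Lut)// ip_scalel//.
  rewrite (ip_subr Ldz Lhd')// (ip_subr Lzh Lzt)// (ip_subr Lzh Lzt)// ip_scaler//.
  by ring.
have zh : normH (z (t + h)) <= normH (z t) + 1.
  have -> : z (t + h) = (fun x => z t x + (z (t + h) x - z t x)).
    by apply/funext => x; ring.
  by rewrite (le_trans (normH_add Lzt Ldz))// lerD2l.
have B1 := ip_norm_le Lru Lzh; have B2 := ip_norm_le Ld Ldz.
have B3 := ip_norm_le Lut Lrz.
have n1 := normH_ge0 (u t); have n2 := normH_ge0 (z t); have n3 := normH_ge0 d.
have h0 := normr_ge0 h.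
pose q := e / (3 * N).
have q0 : 0 <= q * `|h| by rewrite mulr_ge0// ltW.
have C1 : `|ip (fun x => u (t + h) x - u t x - h * d x) (z (t + h))| <= q * `|h| * N.
  apply: (le_trans B1); apply: ler_pM; rewrite ?normH_ge0//.
  by rewrite (le_trans zh)// /N; lra.
have C2 : `|h * ip d (fun x => z (t + h) x - z t x)| <= q * `|h| * N.
  rewrite normrM; have -> : q * `|h| * N = `|h| * (N * q) by ring.
  rewrite ler_wpM2l// (le_trans B2)//; apply: ler_pM; rewrite ?normH_ge0// /N; lra.
have C3 : `|ip (u t) (fun x => z (t + h) x - z t x - h * d' x)| <= q * `|h| * N.
  rewrite mulrC (le_trans B3)//; apply: ler_pM; rewrite ?normH_ge0// /N; lra.
have E : q * `|h| * N *+ 3 = e * `|h|.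
  by rewrite -mulr_natr /q; field; rewrite gt_eqF.
rewrite -E mulrS mulr2n addrA.
rewrite (le_trans (ler_normD _ _))// lerD//.
by rewrite (le_trans (ler_normD _ _))// lerD.
Qed.

End Curves.

(** * Compactly supported subsolutions of the heat equation *)

Section Bump.
Variable R : realType.

Definition pos (y : R) : R := if 0 <= y then y else 0.

Lemma pos_ge0 y : 0 <= pos y.
Proof. by rewrite /pos; case: ifP. Qed.

Lemma pos_le y : pos y <= `|y|.
Proof. by rewrite /pos; case: ifP => // _; rewrite ler_norm. Qed.

Lemma pos_le0 y : y <= 0 -> pos y = 0.
Proof. by rewrite /pos => y0; case: ifP => // y0'; apply/eqP; rewrite eq_le y0. Qed.

Lemma pos_id y : 0 <= y -> pos y = y.
Proof. by rewrite /pos => ->. Qed.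

Lemma pos_lip a b : `|pos a - pos b| <= `|a - b|.
Proof.
rewrite /pos; case: (lerP 0 a) => a0; case: (lerP 0 b) => b0 //.
- by rewrite subr0 !ger0_norm; lra.
- by rewrite sub0r normrN distrC !ger0_norm; lra.
- by rewrite subrr normr0.
Qed.

Lemma pos_mono a b : a <= b -> pos a <= pos b.
Proof. by rewrite /pos => ab; case: (lerP 0 a) => a0; case: (lerP 0 b) => b0 //; lra. Qed.

Lemma pos2_taylor y k : `|pos (y + k) ^+ 2 - pos y ^+ 2 - 2 * pos y * k| <= k ^+ 2.
Proof.
rewrite ler_norml /pos; case: (lerP 0 y) => y0; case: (lerP 0 (y + k)) => k0;
  rewrite !expr2; apply/andP; split; nra.
Qed.

Lemma pos3_taylor y k :
  `|pos (y + k) ^+ 3 - pos y ^+ 3 - 3 * pos y ^+ 2 * k| <=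
  3 * k ^+ 2 * (`|y| + `|k|).
Proof.
rewrite /pos; case: (lerP 0 y) => y0; case: (lerP 0 (y + k)) => k0.
- have -> : (y + k) ^+ 3 - y ^+ 3 - 3 * y ^+ 2 * k = k ^+ 2 * (3 * y + k) by ring.
  rewrite normrM ger0_norm ?sqr_ge0// (ger0_norm y0).
  have := sqr_ge0 k; have : `|3 * y + k| <= 3 * (y + `|k|).
    by rewrite (le_trans (ler_normD _ _))// ger0_norm; have := normr_ge0 k; lra.
  by nra.
- have k1 : k < 0 by lra.
  rewrite (ger0_norm y0) (ltr0_norm k1).
  have -> : 0 ^+ 3 - y ^+ 3 - 3 * y ^+ 2 * k = y ^+ 2 * (- y - 3 * k) by ring.
  rewrite normrM ger0_norm ?sqr_ge0// ger0_norm; last lra.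
  have : y ^+ 2 <= k ^+ 2 by rewrite !expr2; nra.
  have := sqr_ge0 y; nra.
- have k1 : 0 < k by lra.
  rewrite (ltr0_norm y0) (gtr0_norm k1).
  have -> : (y + k) ^+ 3 - 0 ^+ 3 - 3 * 0 ^+ 2 * k = (y + k) ^+ 3 by ring.
  rewrite ger0_norm ?exprn_ge0//.
  have : (y + k) ^+ 2 <= k ^+ 2 by rewrite !expr2; nra.
  rewrite [(y + k) ^+ 3]exprS; have := sqr_ge0 (y + k); nra.
- have -> : (0:R) ^+ 3 - 0 ^+ 3 - 3 * 0 ^+ 2 * k = 0 by ring.
  rewrite normr0; apply: mulr_ge0; last by rewrite addr_ge0.
  by rewrite mulr_ge0 ?sqr_ge0.
Qed.

Lemma pos3_lip a b : a <= 1 -> b <= 1 ->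
  `|pos a ^+ 3 - pos b ^+ 3| <= 3 * `|a - b|.
Proof.
move=> a1 b1.
have p1 y : y <= 1 -> pos y <= 1 by rewrite /pos; case: ifP.
have -> : pos a ^+ 3 - pos b ^+ 3 =
  (pos a - pos b) * (pos a ^+ 2 + pos a * pos b + pos b ^+ 2) by ring.
rewrite normrM mulrC ler_pM//; last exact: pos_lip.
have := pos_ge0 a; have := pos_ge0 b; have := p1 _ a1; have := p1 _ b1 => *.
by rewrite ger0_norm !expr2; nra.
Qed.

(** Fits explicit functions, whose Taylor remainders are computed by algebra; restricting to |h| < 1
    lets cubic terms be absorbed into the quadratic bound. *)
Lemma quad_is_derive (F : R -> R) (x D C : R) :
  (forall h, `|h| < 1 -> `|F (x + h) - F x - D * h| <= C * h ^+ 2) ->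
  is_derive x 1 F D.
Proof.
move=> H; apply/is_derive_eps => e e0.
have C0 : 0 < `|C| + 1 by rewrite ltr_wpDl.
exists (Num.min 1 (e / (`|C| + 1))); first by rewrite lt_min ltr01 divr_gt0.
move=> h; rewrite lt_min => /andP[h1 he].
rewrite (le_trans (H h h1))//.
have -> : h ^+ 2 = `|h| * `|h| by rewrite -normrM -expr2 ger0_norm// sqr_ge0.
rewrite mulrA ler_wpM2r//.
move: he; rewrite ltr_pdivlMr// => he.
have := ler_norm C; have := normr_ge0 h; have := normr_ge0 C; nra.
Qed.

Lemma is_derive1_continuous (f : R -> R) (x D : R) :
  is_derive x 1 f D -> {for x, continuous f}.
Proof.
by move=> [df _]; apply: differentiable_continuous; exact/derivable1_diffP.
Qed.

Lemma pos_continuous : continuous pos.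
Proof.
move=> x; apply/cvgrPdist_le => e e0; apply/nbhs_ballP; exists e => //= y.
by rewrite /ball/= => xy; rewrite (le_trans (pos_lip _ _))// ltW.
Qed.

Variables (r c : R).
Let P (x : R) := r - (x - c) ^+ 2.
(** Supported in the ball of squared radius r about c. The cube makes it of class C^2, so that two
    space derivatives can be moved onto it. *)
Definition bump (x : R) := pos (P x) ^+ 3.
Definition bump' (x : R) := - 6 * (x - c) * pos (P x) ^+ 2.
Definition bump'' (x : R) := - 6 * pos (P x) ^+ 2 + 24 * pos (P x) * (x - c) ^+ 2.

Let P_derive (x : R) : is_derive x 1 P (- 2 * (x - c)).
Proof.
apply: (@quad_is_derive _ _ _ 1) => h _.
have -> : P (x + h) - P x - - 2 * (x - c) * h = - h ^+ 2 by rewrite /P; ring.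
by rewrite normrN ger0_norm ?sqr_ge0// mul1r.
Qed.

Let P_continuous : continuous P.
Proof.
by move=> x; exact: is_derive1_continuous (P_derive x).
Qed.

Lemma pos_parabola_continuous : continuous (fun x => pos (r - (x - c) ^+ 2)).
Proof.
by move=> x; apply: (@continuous_comp _ _ _ P); [exact: P_continuous|exact: pos_continuous].
Qed.

Let lin_continuous (k : R) : continuous (fun x : R => k * (x - c)).
Proof.
move=> x; apply: (@is_derive1_continuous _ _ k).
apply: (@quad_is_derive _ _ _ 0) => h _.
have -> : k * (x + h - c) - k * (x - c) - k * h = 0 by ring.
by rewrite normr0 mul0r.
Qed.

Let bump2_continuous : continuous (fun x => pos (P x) ^+ 2).
Proof.
move=> x; apply: (@continuousM _ _ (fun x => pos (P x)) (fun x => pos (P x)));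
exact: pos_parabola_continuous.
Qed.

Let pos2_derive (y : R) : is_derive y 1 (fun y : R => pos y ^+ 2) (2 * pos y).
Proof.
by apply: (@quad_is_derive _ _ _ 1) => h _; rewrite mul1r; exact: pos2_taylor.
Qed.

Let pos3_derive (y : R) : is_derive y 1 (fun y : R => pos y ^+ 3) (3 * pos y ^+ 2).
Proof.
apply: (@quad_is_derive _ _ _ (3 * (`|y| + 1))) => h h1.
apply: (le_trans (pos3_taylor _ _)).
have := sqr_ge0 h; have := normr_ge0 y; have := normr_ge0 h; nra.
Qed.

Lemma prim_bump : prim bump bump'.
Proof.
apply: C1_prim => x _.
  have H := is_derive1_comp (pos3_derive (P x)) (P_derive x).
  by apply: (is_derive_eq H); rewrite /bump'; ring.
apply: (@continuousM _ _ (fun x => - 6 * (x - c)) (fun x => pos (P x) ^+ 2)).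
  exact: lin_continuous.
exact: bump2_continuous.
Qed.

Lemma prim_bump' : prim bump' bump''.
Proof.
have p1 : prim (fun x => - 6 * (x - c)) (fun _ => - 6).
  apply: C1_prim => x _; last exact: cst_continuous.
  apply: (@quad_is_derive _ _ _ 0) => h _.
  have -> : - 6 * (x + h - c) - - 6 * (x - c) - - 6 * h = 0 by ring.
  by rewrite normr0 mul0r.
have p2 : prim (fun x => pos (P x) ^+ 2) (fun x => 2 * pos (P x) * (- 2 * (x - c))).
  apply: C1_prim => x _.
    have H := is_derive1_comp (pos2_derive (P x)) (P_derive x).
    by apply: (is_derive_eq H).
  apply: (@continuousM _ _ (fun x => 2 * pos (P x)) (fun x => - 2 * (x - c))).
    apply: continuousM; first exact: cst_continuous.
    exact: pos_parabola_continuous.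
  exact: lin_continuous.
have p : prim bump' (fun x => - 6 * pos (P x) ^+ 2 +
    - 6 * (x - c) * (2 * pos (P x) * (- 2 * (x - c)))).
  by apply: (@prim_mul _ _ _ _ _ 6 p1 p2) => x _; rewrite normrN ger0_norm.
rewrite (_ : bump'' = (fun x => - 6 * pos (P x) ^+ 2 +
    - 6 * (x - c) * (2 * pos (P x) * (- 2 * (x - c)))))//.
by apply/funext => x; rewrite /bump''; ring.
Qed.

Lemma bump_ge0 x : 0 <= bump x.
Proof. by rewrite exprn_ge0// pos_ge0. Qed.

Lemma bump_eq0 x : r <= (x - c) ^+ 2 -> bump x = 0.
Proof. by move=> H; rewrite /bump pos_le0 ?expr0n// subr_le0. Qed.

End Bump.

(** * Pairing a supersolution with a moving bump *)

Section Dual.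
Variable R : realType.
Local Notation mu := (@lebesgue_measure R).
Local Notation I := (@I01 R).
Local Notation Rint := (@Defs.Rint R).

(* [d] is the time derivative and [g2] the second space derivative. *)
Definition superflow (tau : R) (U : R -> R -> R) :=
  [/\ forall t, tau < t -> L2 (U t),
      forall t x, tau < t -> 0 <= U t x,
      forall T1 T2, tau < T1 -> T1 <= T2 -> acH T1 T2 U &
      {ae mu, forall t : R, tau < t -> exists d g g1 g2,
        [/\ derivL2 U t d, prim g g1, prim g1 g2, g 0 = 0 /\ g 1 = 0 &
            eqH (U t) g /\ {ae mu, forall x : R, x \in I -> g2 x <= d x}]}].

(** Green's identity: g f1 - f g1 is a primitive of g f2 - f g2 and vanishes at both ends. *)
Lemma ip_by_parts (g g1 g2 f f1 f2 : R -> R) :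
  prim g g1 -> prim g1 g2 -> prim f f1 -> prim f1 f2 ->
  g 0 = 0 -> g 1 = 0 -> f 0 = 0 -> f 1 = 0 -> ip g2 f = ip g f2.
Proof.
move=> pg pg1 pf pf1 g0 g10 f0 f10.
have [C hC] := prim_bounded pg1; have [C' hC'] := prim_bounded pf1.
have p1 := prim_mul pg pf1 hC; have p2 := prim_mul pf pg1 hC'.
have [_ /(_ 1)] := prim_sub p1 p2; rewrite lexx ler01 => /(_ isT).
rewrite g0 g10 f0 f10 !mul0r subrr add0r => /esym.
have -> : Rint 0 1 (fun x => g1 x * f1 x + g x * f2 x - (f1 x * g1 x + f x * g2 x)) =
    Rint 0 1 (fun x => g x * f2 x - f x * g2 x).
  by apply: Rint_eq => z _; ring.
rewrite -[Rint _ _ _]/(\int[mu]_(x in I) (g x * f2 x - f x * g2 x)).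
have Lg := prim_L2 pg; have Lf := prim_L2 pf.
have [Lf2 _] := pf1; have [Lg2 _] := pg1.
rewrite RintegralB; [|exact: measurable_I01|exact: L2_mul_int|exact: L2_mul_int].
by move/eqP; rewrite subr_eq0 => /eqP H; rewrite ipC -[LHS]H.
Qed.

Variables (tau T1 T2 : R) (U : R -> R -> R).
Hypothesis sU : superflow tau U.
Hypothesis tT1 : tau < T1.
Hypothesis T12 : T1 <= T2.
(** A quadratic squared radius and an affine centre cover both uses: the radius affine in time with
    a moving centre, and the squared radius affine in time with a fixed centre. *)
Variables (a0 a1 a2 c0 c1 L : R).
Let rho (t : R) := a0 + a1 * t + a2 * t ^+ 2.
Let rho' (t : R) := a1 + 2 * a2 * t.
Let xi (t : R) := c0 + c1 * t.
Hypothesis L0 : 0 <= L.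
Hypothesis a2L : `|a2| <= L.
Hypothesis c1L : `|c1| <= L.
Hypothesis rho'L : forall t, T1 <= t <= T2 -> `|rho' t| <= L.
Hypothesis rho01 : forall t, T1 <= t <= T2 -> 0 <= rho t <= 1.
Hypothesis xi01 : forall t, T1 <= t <= T2 -> 0 <= xi t <= 1.
(** With the next hypothesis, this keeps the bump inside (0, 1), so that no boundary term
    appears. *)
Hypothesis rho_xi : forall t, T1 <= t <= T2 -> rho t <= xi t ^+ 2.
Hypothesis rho_xi1 : forall t, T1 <= t <= T2 -> rho t <= (1 - xi t) ^+ 2.

Let psi (t : R) := bump (rho t) (xi t).
Let psi_t (t x : R) :=
  3 * pos (rho t - (x - xi t) ^+ 2) ^+ 2 * (rho' t + 2 * (x - xi t) * c1).

Let psi_L2 t : L2 (psi t).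
Proof. exact: prim_L2 (prim_bump _ _). Qed.

Let psi_acH : acH T1 T2 psi.
Proof.
(* A factor 3 from the cube on (-oo, 1], times the Lipschitz constant 3 L in time of rho - (x -
   xi)^2. *)
apply: (@lipschitz_acH _ _ _ _ (9 * L)); first by rewrite mulr_ge0.
move=> s t T1s st tT2.
have sT : T1 <= s <= T2 by rewrite T1s (le_trans st).
have tT : T1 <= t <= T2 by rewrite tT2 (le_trans T1s).
apply: normH_bound; first by rewrite !mulr_ge0// subr_ge0.
  by apply: L2_sub; exact: psi_L2.
move=> x; rewrite I01E => /andP[x0 x1].
have /andP[r0 r1] := rho01 sT; have /andP[r0' r1'] := rho01 tT.
rewrite (le_trans (pos3_lip _ _))//.
- by have := sqr_ge0 (x - xi t); lra.
- by have := sqr_ge0 (x - xi s); lra.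
have -> : 9 * L * (t - s) = 3 * (3 * L * (t - s)) by ring.
rewrite ler_wpM2l//.
(* For a quadratic function the difference quotient is exactly the mean of the two end slopes. *)
have -> : rho t - (x - xi t) ^+ 2 - (rho s - (x - xi s) ^+ 2) =
  ((rho' t + rho' s) / 2 + c1 * ((x - xi t) + (x - xi s))) * (t - s).
  by rewrite /rho /rho' /xi; field.
rewrite normrM (ger0_norm (x := t - s)) ?subr_ge0// ler_wpM2r ?subr_ge0//.
have := rho'L sT; have := rho'L tT.
have /andP[? ?] := xi01 sT; have /andP[? ?] := xi01 tT.
rewrite !ler_norml => /andP[? ?] /andP[? ?].
have : `|c1 * ((x - xi t) + (x - xi s))| <= L * 2.
  by rewrite normrM ler_pM// ler_norml; apply/andP; split; lra.
by rewrite ler_norml => /andP[? ?]; apply/andP; split; lra.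
Qed.

Let psi_deriv t : T1 <= t <= T2 -> derivL2 psi t (psi_t t).
Proof.
move=> tT; have /andP[r0 r1] := rho01 tT; have /andP[y0 y1] := xi01 tT.
have mt : L2 (psi_t t).
  have p1 : prim (fun x => rho' t + 2 * (x - xi t) * c1) (fun _ => 2 * c1).
    apply: C1_prim => x _; last exact: cst_continuous.
    apply: (@quad_is_derive _ _ _ _ 0) => h _.
    have -> : rho' t + 2 * (x + h - xi t) * c1 - (rho' t + 2 * (x - xi t) * c1) -
      2 * c1 * h = 0 by ring.
    by rewrite normr0 mul0r.
  have [C hC] := prim_bounded p1.
  apply: (@bounded_L2 _ _ (3 * C)).
    apply: measurable_funM; last exact: prim_measurable p1.
    apply: measurable_funM; first exact: measurable_cst.
    apply: measurable_funX; apply: measurable_funTS.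
    apply: continuous_measurable_fun; exact: pos_parabola_continuous.
  move=> x Ix; rewrite /psi_t normrM; apply: ler_pM => //; last exact: hC.
  have := pos_ge0 (rho t - (x - xi t) ^+ 2).
  have : pos (rho t - (x - xi t) ^+ 2) <= 1.
    by rewrite /pos; case: ifP => // _; have := sqr_ge0 (x - xi t); lra.
  by rewrite ger0_norm !expr2; nra.
split => // e e0.
(* Bounds |k| / |h| for the increment [k] below: 3 L from its linear coefficient, L + L^2 from its
   quadratic one. *)
pose K := 4 * L + L ^+ 2.
have K0 : 0 <= K by rewrite addr_ge0 ?mulr_ge0 ?sqr_ge0.
(* The first summand bounds the remainder in [pos3_taylor]; the second bounds the part of order h^2
   in the increment [k], which [psi_t] leaves out. *)
pose C := 3 * K ^+ 2 * (1 + K) + 3 * (L + L ^+ 2).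
have C0 : 0 <= C.
  have K2 := sqr_ge0 K; have LL := sqr_ge0 L.
  by apply: addr_ge0; apply: mulr_ge0; rewrite ?addr_ge0// mulr_ge0.
have C1 : 0 < C + 1 by rewrite ltr_wpDl.
exists (Num.min 1 (e / (C + 1))); first by rewrite lt_min ltr01 divr_gt0.
move=> h; rewrite lt_min ltr_pdivlMr// => /andP[h1 he].
have h0 := normr_ge0 h.
have hh : h ^+ 2 = `|h| * `|h| by rewrite -normrM -expr2 ger0_norm// sqr_ge0.
apply: (@le_trans _ _ (C * h ^+ 2)); last first.
  by rewrite hh mulrA ler_wpM2r//; nra.
apply: normH_bound; first by rewrite mulr_ge0// sqr_ge0.
  by apply: L2_sub; [apply: L2_sub; exact: psi_L2|exact: L2_scale].
move=> x; rewrite I01E => /andP[x0 x1].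
pose y := x - xi t.
pose P := rho t - y ^+ 2.
pose k := (rho' t + 2 * y * c1) * h + (a2 - c1 ^+ 2) * h ^+ 2.
have y1' : -1 <= y <= 1 by rewrite /y; apply/andP; split; lra.
have yn : `|y| <= 1 by rewrite ler_norml.
have PE : rho (t + h) - (x - xi (t + h)) ^+ 2 = P + k.
  by rewrite /P /k /y /rho /rho' /xi; ring.
have -> : psi (t + h) x - psi t x - h * psi_t t x =
    (pos (P + k) ^+ 3 - pos P ^+ 3 - 3 * pos P ^+ 2 * k) +
    3 * pos P ^+ 2 * ((a2 - c1 ^+ 2) * h ^+ 2).
  by rewrite /psi /bump PE /psi_t -/y -/P /k; ring.
have y2 : 0 <= y ^+ 2 <= 1 by rewrite sqr_ge0 -[y ^+ 2]real_normK ?num_real// exprn_ile1.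
have P1 : `|P| <= 1 by rewrite ler_norml /P; apply/andP; split; lra.
have pP : pos P <= 1 by rewrite (le_trans (pos_le P)).
have ac : `|a2 - c1 ^+ 2| <= L + L ^+ 2.
  rewrite (le_trans (ler_normB _ _))// lerD// normrX.
  by rewrite lerXn2r// nnegrE.
have kK : `|k| <= K * `|h|.
  have k1 : `|rho' t + 2 * y * c1| <= 3 * L.
    rewrite (le_trans (ler_normD _ _))//.
    have -> : 3 * L = L + 2 * 1 * L by ring.
    rewrite lerD ?rho'L// !normrM ler_pM// ?ler_pM// ger0_norm//.
  rewrite (le_trans (ler_normD _ _))// !normrM.
  have : `|a2 - c1 ^+ 2| * (`|h| * `|h|) <= (L + L ^+ 2) * `|h|.
    by apply: ler_pM => //; nra.
  have : `|rho' t + 2 * y * c1| * `|h| <= 3 * L * `|h| by rewrite ler_wpM2r.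
  by rewrite /K; lra.
have k2 : k ^+ 2 <= K ^+ 2 * h ^+ 2.
  rewrite -exprMn -[k ^+ 2]real_normK ?num_real// -[leRHS]real_normK ?num_real//.
  by rewrite lerXn2r ?nnegrE// normrM (ger0_norm K0).
have k3 : `|k| <= K by rewrite (le_trans kK)// ler_piMr// ltW.
rewrite (le_trans (ler_normD _ _))// /C [leRHS]mulrDl lerD//.
  rewrite (le_trans (pos3_taylor _ _))//.
  have -> : 3 * K ^+ 2 * (1 + K) * h ^+ 2 = 3 * (K ^+ 2 * h ^+ 2) * (1 + K) by ring.
  apply: ler_pM.
  - by apply: mulr_ge0 => //; exact: sqr_ge0.
  - by rewrite addr_ge0.
  - by rewrite ler_wpM2l.
  - exact: lerD.
have -> : 3 * (L + L ^+ 2) * h ^+ 2 = 3 * 1 * ((L + L ^+ 2) * h ^+ 2) by ring.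
have /andP[q0 q1] : 0 <= pos P ^+ 2 <= 1 by rewrite sqr_ge0 exprn_ile1// pos_ge0.
rewrite normrM; apply: ler_pM => //.
  by rewrite ger0_norm; lra.
by rewrite normrM (ger0_norm (sqr_ge0 h)) ler_wpM2r// sqr_ge0.
Qed.

(** An integrating factor: with A' = kap A, the bump need only be a subsolution up to the zero order
    term kap psi. *)
Variables (A kap : R -> R) (M : R).
Hypothesis A0 : forall t, T1 <= t <= T2 -> 0 <= A t <= M.
Hypothesis dA : forall t : R, T1 <= t <= T2 -> is_derive t 1 A (kap t * A t).
Hypothesis lipA : forall s t, T1 <= s -> s <= t -> t <= T2 ->
  `|A t - A s| <= M * (t - s).
(* Multiplied by [P], the expression below is psi_t + psi_xx + kap psi. *)
Hypothesis subsol : forall t y P : R, T1 <= t <= T2 -> P = rho t - y ^+ 2 -> 0 <= P ->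
  `|y| <= 1 ->
  0 <= 24 * rho t - 30 * P + 3 * P * (rho' t + 2 * y * c1) + kap t * P ^+ 2.

(** After integration by parts the derivative is at least A <U, psi_xx + psi_t + kap psi>, an
    integral of nonnegative functions. *)
Lemma dual_monotone : A T1 * ip (U T1) (psi T1) <= A T2 * ip (U T2) (psi T2).
Proof.
have [LU U0 acU aeU] := sU.
have tT t : T1 <= t <= T2 -> tau < t by move=> /andP[+ _]; exact: lt_le_trans.
have LU' t : T1 <= t <= T2 -> L2 (U t) by move=> /tT; exact: LU.
have M0 : 0 <= M.
  by have := A0 (t := T1); rewrite lexx T12 => /(_ isT) /andP[]; exact: le_trans.
have acF : abs_contR T1 T2 (fun t => ip (U t) (psi t)).
  by apply: ip_abs_contR => //; exact: acU.
have acA : abs_contR T1 T2 A by exact: lipschitz_abs_contR lipA.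
have [B B0 HB] : exists2 B : R, 0 <= B & forall t, T1 <= t <= T2 ->
    `|ip (U t) (psi t)| <= B.
  have [B1 B10 HB1] := acH_bounded T12 LU' (acU _ _ tT1 T12).
  have [B2 B20 HB2] := acH_bounded T12 (fun t _ => psi_L2 t) psi_acH.
  exists (B1 * B2); first exact: mulr_ge0.
  move=> t tT12; rewrite (le_trans (ip_norm_le (LU' _ tT12) (psi_L2 t)))//.
  by rewrite ler_pM ?normH_ge0 ?HB1 ?HB2.
apply: (@abs_cont_nondecreasing _ T1 T2 (fun t => A t * ip (U t) (psi t))) => //.
  apply: (@abs_contR_mul _ _ _ (M + B)) => //; first exact: addr_ge0.
  move=> t tT12; have /andP[At0 AtM] := A0 tT12; have := HB t tT12.
  by rewrite (ger0_norm At0); lra.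
apply: aeS aeU => t Ht tT12.
have [d [g [g1 [g2 [dU pg pg1 [g00 g10] [Ug g2d]]]]]] := Ht (tT _ tT12).
have dF := ip_is_derive (tT _ tT12) LU (fun s _ => psi_L2 s) dU (psi_deriv tT12).
exists (A t * (ip d (psi t) + ip (U t) (psi_t t)) + kap t * A t * ip (U t) (psi t)); last first.
  have H : is_derive t 1 (fun s => A s * ip (U s) (psi s)) _ :=
    is_deriveM (dA tT12) dF.
  by apply: (is_derive_eq H); rewrite /GRing.scale/=; ring.
have [Ld _] := dU; have [Lg2 _] := pg1; have LUt := LU' _ tT12.
have Lpt : L2 (psi_t t) by have [] := psi_deriv tT12.
have pp := prim_bump (rho t) (xi t); have pp' := prim_bump' (rho t) (xi t).
have Lpp : L2 (bump'' (rho t) (xi t)) by have [] := pp'.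
have K1 : ip (U t) (bump'' (rho t) (xi t)) <= ip d (psi t).
  rewrite (@ip_eqH _ (U t) g _ (bump'' (rho t) (xi t)))//.
  - rewrite -(ip_by_parts pg pg1 pp pp') //.
    + apply: ip_ae_le => //; [exact: psi_L2|move=> x _; exact: bump_ge0].
    + by apply: bump_eq0; rewrite sub0r sqrrN; exact: rho_xi.
    + by apply: bump_eq0; exact: rho_xi1.
  - exact: prim_L2 pg.
  - exact: aeW.
have /andP[At0 _] := A0 tT12.
suff K2 : 0 <= ip (U t) (bump'' (rho t) (xi t)) + ip (U t) (psi_t t) +
    kap t * ip (U t) (psi t).
  have -> : A t * (ip d (psi t) + ip (U t) (psi_t t)) + kap t * A t * ip (U t) (psi t)
    = A t * (ip d (psi t) + ip (U t) (psi_t t) + kap t * ip (U t) (psi t)) by ring.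
  by rewrite mulr_ge0//; lra.
have Lps := psi_L2 t.
rewrite -ip_scaler// -!ip_addr//; last 2 first.
- exact: L2_add.
- exact: L2_scale.
apply: Rintegral_ge0 => x; rewrite I01E => /andP[x0 x1].
apply: mulr_ge0; first by apply: U0; exact: tT.
pose y := x - xi t.
rewrite /bump'' /psi_t /psi /bump -/y.
have [P0|P0] := leP 0 (rho t - y ^+ 2); last first.
  by rewrite (pos_le0 (ltW P0)) [X in 0 <= X](_ : _ = 0)//; ring.
rewrite pos_id//.
have /andP[y0 y1] := xi01 tT12.
have := @subsol t y (rho t - y ^+ 2) tT12 erefl P0.
set P := rho t - y ^+ 2 in P0 *.
have -> : y ^+ 2 = rho t - P by rewrite /P; ring.
have yn : `|y| <= 1 by rewrite ler_norml /y; apply/andP; split; lra.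
move=> /(_ yn) S.
have -> : - 6 * P ^+ 2 + 24 * P * (rho t - P) + 3 * P ^+ 2 * (rho' t + 2 * y * c1) +
    kap t * P ^+ 3 = P * (24 * rho t - 30 * P + 3 * P * (rho' t + 2 * y * c1) +
    kap t * P ^+ 2) by ring.
exact: mulr_ge0.
Qed.

End Dual.

(** * Strong maximum principle *)

Section StrongMaximumPrinciple.
Variable R : realType.
Local Notation I := (@I01 R).
Local Notation Rint := (@Defs.Rint R).

Lemma derive_lipschitz (T1 T2 M : R) (A D : R -> R) :
  (forall t : R, T1 <= t <= T2 -> is_derive t 1 A (D t)) ->
  (forall t, T1 <= t <= T2 -> `|D t| <= M) ->
  forall s t, T1 <= s -> s <= t -> t <= T2 -> `|A t - A s| <= M * (t - s).
Proof.
move=> dA DM s t T1s st tT2.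
have H z : s <= z <= t -> T1 <= z <= T2.
  by move=> /andP[sz zt]; rewrite (le_trans T1s)// (le_trans zt).
have [||c] := @MVT_segment _ A D s t st.
- move=> z; rewrite in_itv/= => /andP[/ltW sz /ltW zt].
  by apply: dA; apply: H; rewrite sz.
- apply: derivable_within_continuous => z; rewrite in_itv/= => /H/dA.
  by case.
rewrite in_itv/= => cst ->; rewrite normrM (ger0_norm (x := t - s)) ?subr_ge0//.
by rewrite ler_wpM2r ?subr_ge0// DM// H.
Qed.

(** The bump starts with centre and radius 1/2, filling (0, 1), and both move at constant speed to
    [x0] and [e]. The cost of the motion is paid by the weight exp (K (t - t1)). *)
Lemma superflow_spread (tau t0 t1 e x0 : R) (U : R -> R -> R) :
  superflow tau U -> tau < t0 -> t0 < t1 -> 0 < e -> e <= x0 -> e <= 1 - x0 ->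
  0 < ip (U t0) (bump (1 / 4) (1 / 2)) -> 0 < ip (U t1) (bump (e ^+ 2) x0).
Proof.
move=> sU tau0 t01 e0 ex0 ex1 F0.
pose D := t1 - t0.
have D0 : 0 < D by rewrite subr_gt0.
have Dn0 : D != 0 by rewrite gt_eqF.
pose p1 := (e - 1 / 2) / D; pose p0 := 1 / 2 - p1 * t0.
pose c1 := (x0 - 1 / 2) / D; pose c0 := 1 / 2 - c1 * t0.
pose q := 1 / 2 / D.
have q0 : 0 <= q by rewrite /q divr_ge0// ltW.
have iD : 0 <= D^-1 by rewrite invr_ge0 ltW.
have p1q : `|p1| <= q.
  rewrite /p1 /q normrM (ger0_norm iD) ler_wpM2r//.
  by rewrite ler_norml; apply/andP; split; lra.
have c1q : `|c1| <= q.
  rewrite /c1 /q normrM (ger0_norm iD) ler_wpM2r//.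
  by rewrite ler_norml; apply/andP; split; lra.
pose s := 30 + 9 * q.
(* Makes 24 e^2 - s P + K P^2 a perfect square. In [s], 30 comes from the second space derivative
   and 9 q from the motion, [q] bounding both speeds. *)
pose K := s ^+ 2 / (96 * e ^+ 2).
have e2 : 0 < e ^+ 2 by rewrite exprn_gt0.
have K0 : 0 <= K by rewrite divr_ge0 ?sqr_ge0// mulr_ge0// ltW.
pose r t := p0 + p1 * t.
(* [l] is the elapsed fraction of time: the bump stays inside [0, 1] because it does so at both ends
   and everything is affine in [l]. *)
have T t : t0 <= t <= t1 -> exists l : R, [/\ 0 <= l <= 1,
    r t = 1 / 2 + (e - 1 / 2) * l & c0 + c1 * t = 1 / 2 + (x0 - 1 / 2) * l].
  move=> /andP[t0t tt1]; exists ((t - t0) / D); split.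
  - apply/andP; split; first by rewrite mulr_ge0// subr_ge0.
    by rewrite ler_pdivrMr// mul1r /D; lra.
  - by rewrite /r /p0 /p1; field.
  - by rewrite /c0 /c1; field.
have rE t : p0 ^+ 2 + 2 * p0 * p1 * t + p1 ^+ 2 * t ^+ 2 = r t ^+ 2.
  by rewrite /r; ring.
have rb t : t0 <= t <= t1 -> [/\ e <= r t, r t <= 1 / 2,
    r t <= c0 + c1 * t & r t <= 1 - (c0 + c1 * t)].
  by move=> /T[l [/andP[l0 l1] -> ->]]; split; nra.
have := @dual_monotone _ _ _ _ _ sU tau0 (ltW t01)
  (p0 ^+ 2) (2 * p0 * p1) (p1 ^+ 2) c0 c1 (q + q ^+ 2).
have A1 (t : R) : is_derive t 1 (fun t => expR (K * (t - t1))) (K * expR (K * (t - t1))).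
  have H : is_derive t 1 (fun t => K * (t - t1)) K.
    apply: (@quad_is_derive _ _ _ _ 0) => h _.
    have -> : K * (t + h - t1) - K * (t - t1) - K * h = 0 by ring.
    by rewrite normr0 mul0r.
  have H' := @is_derive1_comp _ expR (fun t => K * (t - t1)) t _ _ (is_derive_expR _) H.
  by apply: (is_derive_eq H'); rewrite mulrC.
have A2 t : t0 <= t <= t1 -> 0 <= expR (K * (t - t1)) <= 1.
  move=> /andP[_ tt1]; rewrite expR_ge0/= -expR0 ler_expR mulr_ge0_le0//; lra.
move=> /(_ _ _ _ _ _ _ _ _ (fun t => expR (K * (t - t1))) (fun _ => K) (K + 1)).
rewrite !rE => H.
have {H} : expR (K * (t0 - t1)) * ip (U t0) (bump (r t0 ^+ 2) (c0 + c1 * t0)) <=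
    expR (K * (t1 - t1)) * ip (U t1) (bump (r t1 ^+ 2) (c0 + c1 * t1)).
  apply: H.
  - by rewrite addr_ge0 ?sqr_ge0.
  - rewrite normrX ler_wpDl// lerXn2r// nnegrE//.
  - by rewrite (le_trans c1q)// lerDl sqr_ge0.
  - move=> t /rb[r1 r2 _ _].
    have -> : 2 * p0 * p1 + 2 * p1 ^+ 2 * t = 2 * r t * p1 by rewrite /r; ring.
    rewrite normrM (ger0_norm (x := 2 * r t)); last by lra.
    have := normr_ge0 p1; have := sqr_ge0 q; nra.
  - move=> t /rb[r1 r2 _ _]; rewrite rE sqr_ge0 expr2 /=; nra.
  - move=> t /rb[r1 r2 r3 r4]; apply/andP; split; lra.
  - move=> t /rb[r1 r2 r3 r4]; rewrite rE lerXn2r// nnegrE; lra.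
  - move=> t /rb[r1 r2 r3 r4]; rewrite rE lerXn2r// nnegrE; lra.
  - by move=> t /A2/andP[-> H]; rewrite (le_trans H)// lerDr.
  - apply: (derive_lipschitz (fun t _ => A1 t)) => t /A2/andP[H1 H2].
    rewrite (ger0_norm (mulr_ge0 K0 H1)) (le_trans (ler_wpM2l K0 H2))//.
    by rewrite mulr1 lerDl.
  - move=> t y P /rb[r1 r2 r3 r4] PE P0 y1.
    rewrite rE in PE *.
    have -> : 2 * p0 * p1 + 2 * p1 ^+ 2 * t = 2 * r t * p1 by rewrite /r; ring.
    have m1 : `|2 * r t * p1 + 2 * y * c1| <= 3 * q.
      rewrite (le_trans (ler_normD _ _))//.
      have -> : 3 * q = 1 * q + 2 * q by ring.
      apply: lerD; rewrite normrM; apply: ler_pM => //.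
        by rewrite ger0_norm; lra.
      by rewrite normrM (ger0_norm (x := 2))//; lra.
    move: m1; rewrite ler_norml => /andP[m1 _].
    have er : e ^+ 2 <= r t ^+ 2 by rewrite lerXn2r// nnegrE; lra.
    have sq : 24 * e ^+ 2 - s * P + K * P ^+ 2 = 24 * (e - s * P / (48 * e)) ^+ 2.
      by rewrite /K; field; rewrite gt_eqF.
    have := sqr_ge0 (e - s * P / (48 * e)).
    have : 0 <= P * (2 * r t * p1 + 2 * y * c1 + 3 * q) by rewrite mulr_ge0//; lra.
    rewrite /s in sq *; lra.
have r0E : r t0 = 1 / 2 by rewrite /r /p0; ring.
have r1E : r t1 = e by rewrite /r /p0 /p1 /D; field.
have x0E : c0 + c1 * t0 = 1 / 2 by rewrite /c0; ring.
have x1E : c0 + c1 * t1 = x0 by rewrite /c0 /c1 /D; field.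
rewrite r0E r1E x0E x1E subrr mulr0 expR0 [1 * ip _ _]mul1r.
have -> : (1 / 2 : R) ^+ 2 = 1 / 4 by field.
by apply: lt_le_trans; rewrite mulr_gt0// expR_gt0.
Qed.

Lemma bump_mono (r r' c x : R) : r <= r' -> bump r c x <= bump r' c x.
Proof.
move=> rr; rewrite /bump lerXn2r ?nnegrE ?pos_ge0//.
by apply: pos_mono; rewrite lerD2r.
Qed.

Lemma bump_int_le (e x0 : R) : 0 < e -> e <= x0 -> e <= 1 - x0 ->
  ip (fun _ => 1) (bump (e ^+ 2) x0) <= (e ^+ 2) ^+ 3 * (2 * e).
Proof.
move=> e0 ex0 ex1.
have Lb : L2 (bump (e ^+ 2) x0) by exact: prim_L2 (prim_bump _ _).
have x1 : 0 <= x0 - e by lra.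
have x2 : x0 + e <= 1 by lra.
have -> : ip (fun _ => 1) (bump (e ^+ 2) x0) = Rint (x0 - e) (x0 + e) (bump (e ^+ 2) x0).
  rewrite RintE//; apply: eq_Rintegral => x _; rewrite mul1r indicE.
  case: (boolP (x \in _)) => [_|]; first by rewrite mulr1.
  rewrite notin_setE/= in_itv/= => /negP; rewrite negb_and -!ltNge => H.
  rewrite mulr0 bump_eq0//; rewrite !expr2.
  by case/orP: H => H; nra.
have -> : 2 * e = (x0 + e) - (x0 - e) by ring.
apply: (le_trans (ler_norm _)); apply: Rint_le_bound => //; first by lra.
move=> z _; rewrite ger0_norm ?bump_ge0// /bump lerXn2r ?nnegrE ?pos_ge0 ?sqr_ge0//.
rewrite /pos; case: ifP => _; last exact: sqr_ge0.
by rewrite gerBl sqr_ge0.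
Qed.

(* The heat kernel is replaced by the compactly supported subsolution
   rho^(-15/4) (rho - y^2)_+^3 with rho = e^2 + 10 s: starting from a bump of
   radius e, its mass only decays like e^(1/2), so that a Lipschitz function
   vanishing at [x0] cannot dominate it. *)
Lemma superflow_pos (tau t0 t1 : R) (U : R -> R -> R) (g g1 g2 : R -> R) :
  superflow tau U -> tau < t0 -> t0 < t1 ->
  0 < ip (U t0) (bump (1 / 4) (1 / 2)) ->
  prim g g1 -> prim g1 g2 -> eqH (U t1) g ->
  forall x0, 0 < x0 < 1 -> 0 < g x0.
Proof.
move=> sU tau0 t01 F0 pg pg1 Ug x0 /andP[x00 x01].
have [LU U0 _ _] := sU.
have [C0 hC0] := prim_bounded pg1.
pose C : R := `|C0| + 1.
have C1 : 0 < C by rewrite /C ltr_wpDl.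
have hC x : I x -> `|g1 x| <= C.
  by move=> Ix; rewrite (le_trans (hC0 x Ix))// /C (le_trans (ler_norm _))// lerDl.
rewrite ltNge; apply/negP => gx0.
pose w : R := Num.min x0 (1 - x0).
have w0 : 0 < w by rewrite lt_min x00 subr_gt0.
have wx0 : w <= x0 by rewrite ge_min lexx.
have wx1 : w <= 1 - x0 by rewrite ge_min lexx orbT.
have w1 : w <= 1 / 2 by lra.
have w2 : 0 < w ^+ 2 by rewrite exprn_gt0.
have w2' : w ^+ 2 <= 1 / 4 by rewrite expr2; nra.
(* Length of the time window before [t1]: growing at rate 10, the squared radius gains at most w^2 /
   2, and the window starts after [t0]. *)
pose S := Num.min (w ^+ 2 / 20) ((t1 - t0) / 2).
have S0 : 0 < S by rewrite lt_min; apply/andP; split; lra.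
have S1 : S <= w ^+ 2 / 20 by rewrite ge_min lexx.
have S2 : S <= (t1 - t0) / 2 by rewrite ge_min lexx orbT.
pose t' := t1 - S.
have tt' : t0 < t' by rewrite /t'; lra.
have tau' : tau < t' by exact: lt_trans tt'.
(* This mass does not depend on the small radius [d ^+ 2], which can therefore be chosen afterwards
   in terms of it. *)
pose m := ip (U t') (bump (10 * S) x0).
have m0 : 0 < m.
  have H : Num.sqrt (10 * S) <= w.
    have -> : w = Num.sqrt (w ^+ 2) by rewrite sqrtr_sqr ger0_norm// ltW.
    by rewrite ler_wsqrtr//; lra.
  have -> : m = ip (U t') (bump (Num.sqrt (10 * S) ^+ 2) x0).
    by rewrite sqr_sqrtr// mulr_ge0// ltW.
  apply: (superflow_spread sU tau0 tt' _ _ _ F0).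
  - by rewrite sqrtr_gt0 mulr_gt0.
  - exact: le_trans wx0.
  - exact: le_trans wx1.
(* The radius at [t1] is d^2, so that all powers are integral. The second bound contradicts the
   final estimate m <= 2 C d. *)
pose d := Num.min (w ^+ 2 / 2) (m / (4 * C)).
have d0 : 0 < d by rewrite lt_min !divr_gt0// mulr_gt0.
have d1 : d <= w ^+ 2 / 2 by rewrite ge_min lexx.
have d2 : d <= m / (4 * C) by rewrite ge_min lexx orbT.
have dl1 : d <= 1 / 8 by lra.
have d4 : d ^+ 4 <= d by rewrite ler_iXnr// ?ltW//; lra.
have d40 : 0 < d ^+ 4 by rewrite exprn_gt0.
(* The squared radius, shrinking to d^4 at [t1]; the zero term gives it the shape of [rho] in
   [dual_monotone]. *)
pose r (t : R) : R := d ^+ 4 + 10 * t1 + - 10 * t + 0 * t ^+ 2.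
have rb (t : R) : t' <= t <= t1 -> d ^+ 4 <= r t <= w ^+ 2.
  by rewrite /r /t' => /andP[? ?]; apply/andP; split; lra.
have rp (t : R) : t' <= t <= t1 -> 0 < r t by move=> /rb /andP[+ _]; exact: lt_le_trans.
pose A (t : R) := expR (- (15 / 4) * ln (r t)).
pose M1 := expR (- (15 / 4) * ln (d ^+ 4)).
have At (t : R) : t' <= t <= t1 -> 1 <= A t <= M1.
  move=> tT; have rp0 := rp t tT; have /andP[r1 r2] := rb t tT.
  rewrite /A /M1 -[X in X <= _]expR0 !ler_expR; apply/andP; split.
    have : ln (r t) <= 0 by apply: ln_le0; lra.
    by lra.
  have : ln (d ^+ 4) <= ln (r t) by rewrite ler_ln ?posrE.
  by lra.
have dA (t : R) : t' <= t <= t1 -> is_derive t 1 A (75 / 2 / r t * A t).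
  move=> tT.
  have dr : is_derive t 1 r (- 10).
    apply: (@quad_is_derive _ _ _ _ 0) => h _.
    have -> : r (t + h) - r t - - 10 * h = 0 by rewrite /r; ring.
    by rewrite normr0 mul0r.
  have H1 := is_derive1_comp (is_derive1_ln (rp t tT)) dr.
  have H2 : is_derive (ln (r t)) 1 (fun y : R => - (15 / 4) * y) (- (15 / 4)).
    apply: (@quad_is_derive _ _ _ _ 0) => h _.
    have -> : - (15 / 4) * (ln (r t) + h) - - (15 / 4) * ln (r t) - - (15 / 4) * h = 0.
      by ring.
    by rewrite normr0 mul0r.
  have H3 := @is_derive1_comp _ (fun y : R => - (15 / 4) * y) (@ln R \o r) t _ _ H2 H1.
  have H4 := @is_derive1_comp _ expR ((fun y : R => - (15 / 4) * y) \o (@ln R \o r))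
    t _ _ (is_derive_expR _) H3.
  apply: (is_derive_eq H4); rewrite /A/=.
  by field; rewrite gt_eqF// rp.
have M1p : 0 < M1 by exact: expR_gt0.
pose M := M1 + 75 / 2 / d ^+ 4 * M1.
have M2p : 0 < 75 / 2 / d ^+ 4 * M1 by rewrite mulr_gt0// divr_gt0// divr_gt0.
have T1' : t' <= t1 by rewrite /t'; lra.
have := @dual_monotone _ _ _ _ _ sU tau' T1' (d ^+ 4 + 10 * t1) (- 10) 0 x0 0 10.
move=> /(_ _ _ _ _ _ _ _ _ A (fun t => 75 / 2 / r t) M).
rewrite -/(r t') -/(r t1) !mul0r !addr0 => H.
have {}H : A t' * ip (U t') (bump (r t') x0) <= A t1 * ip (U t1) (bump (r t1) x0).
  apply: H => //.
  - by rewrite normr0.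
  - by rewrite normr0.
  - by move=> t _; rewrite mulr0 mul0r addr0 normrN ger0_norm.
  - by move=> t tT; have := rb t tT; rewrite /r => /andP[? ?]; apply/andP; split; lra.
  - by move=> t _; rewrite mul0r addr0; apply/andP; split; lra.
  - move=> t tT; have /andP[_] := rb t tT; rewrite /r.
    have : w ^+ 2 <= x0 ^+ 2 by rewrite lerXn2r// nnegrE; lra.
    have -> : x0 + 0 * t = x0 by ring.
    by lra.
  - move=> t tT; have /andP[_] := rb t tT; rewrite /r.
    have : w ^+ 2 <= (1 - x0) ^+ 2 by rewrite lerXn2r// nnegrE; lra.
    have -> : x0 + 0 * t = x0 by ring.
    by lra.
  - move=> t /At/andP[H1 H2]; apply/andP; split; first lra.
    by rewrite /M; lra.
  - apply: (derive_lipschitz dA) => t tT.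
    have rp0 := rp t tT; have /andP[r1 _] := rb t tT; have /andP[A1 A2] := At t tT.
    rewrite ger0_norm; last by rewrite mulr_ge0 ?divr_ge0 ?ltW//; lra.
    apply: (@le_trans _ _ (75 / 2 / d ^+ 4 * M1)); last by rewrite /M; lra.
    apply: ler_pM => //; [by rewrite divr_ge0// ltW|by lra|].
    by rewrite ler_wpM2l// lef_pV2 ?posrE.
  - move=> t y P tT -> P0 y1; rewrite -/(r t) in P0 *.
    have rp0 := rp t tT; set P' := r t - y ^+ 2 in P0 *.
    (* Origin of the constants: for a rate a and a weight r^(-k), this is 24 r - (30 + 3 a) P + k a
       P^2 / r, a perfect square when k = 3 (10 + a)^2 / (32 a). That is least at a = 10, where k =
       15/4. The contradiction needs k < 4: with final radius e, the pairing is of order e^(-2 k)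
       times e (Lipschitz bound), e^6 (height) and e (width). *)
    have -> : 24 * r t - 30 * P' + 3 * P' * (-10 + 2 * 0 * t + 2 * y * 0) +
        75 / 2 / r t * P' ^+ 2 = 24 / r t * (r t - 5 / 4 * P') ^+ 2.
      by field; rewrite gt_eqF.
    by rewrite mulr_ge0 ?sqr_ge0// divr_ge0// ltW.
have Lb (c' : R) : L2 (bump c' x0) by exact: prim_L2 (prim_bump _ _).
have tau1 : tau < t1 by exact: lt_trans t01.
have lhs : m <= A t' * ip (U t') (bump (r t') x0).
  have mm : m <= ip (U t') (bump (r t') x0).
    apply: le_Rintegral.
    - exact: measurable_I01.
    - by apply: L2_mul_int => //; exact: LU.
    - by apply: L2_mul_int => //; exact: LU.
    - move=> x _; rewrite ler_wpM2l ?U0//; apply: bump_mono.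
      by rewrite /r /t'; lra.
  have /andP[A1 _] : 1 <= A t' <= M1 by apply: At; rewrite lexx T1'.
  by nra.
have r1E : r t1 = (d ^+ 2) ^+ 2 by rewrite /r; ring.
have d2w : d ^+ 2 <= w.
  by rewrite expr2; nra.
have d20 : 0 < d ^+ 2 by rewrite exprn_gt0.
have rhs : ip (U t1) (bump (r t1) x0) <= C * d ^+ 2 * ((d ^+ 4) ^+ 3 * (2 * d ^+ 2)).
  have Lg := prim_L2 pg.
  rewrite (@ip_eqH _ (U t1) g _ (bump (r t1) x0))//; last 2 first.
  - exact: LU.
  - exact: aeW.
  apply: (@le_trans _ _ (ip (fun _ => C * d ^+ 2 * 1) (bump (r t1) x0))).
    apply: le_Rintegral; [exact: measurable_I01|exact: L2_mul_int| |].
      by apply: L2_mul_int => //; exact: L2_cst.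
    move=> x; rewrite I01E => /andP[xx0 xx1]; rewrite mulr1.
    have [Hx|Hx] := leP ((d ^+ 2) ^+ 2) ((x - x0) ^+ 2).
      by rewrite r1E bump_eq0// !mulr0.
    rewrite ler_wpM2r ?bump_ge0//.
    have xd : `|x - x0| <= d ^+ 2.
      rewrite -(ger0_norm (ltW d20)) -ler_sqr ?nnegrE//.
      by rewrite !real_normK ?num_real// ltW.
    have gg : `|g x - g x0| <= C * `|x - x0|.
      have [xx|xx] := leP x x0.
        rewrite distrC (prim_incr pg)// ?(ltW x01)//.
        rewrite distrC (ger0_norm (x := x0 - x)) ?subr_ge0//.
        have [Lg1 _] := pg; apply: Rint_le_bound => //; first exact: ltW.
        move=> z /andP[xz zx]; apply: hC; rewrite I01E.
        by rewrite (le_trans xx0 xz) (le_trans zx)// ltW.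
      rewrite (prim_incr pg) ?(ltW xx) ?(ltW x00)//.
      rewrite (ger0_norm (x := x - x0)) ?subr_ge0 ?(ltW xx)//.
      have [Lg1 _] := pg; apply: Rint_le_bound => //; try exact: ltW.
      move=> z /andP[xz zx]; apply: hC; rewrite I01E.
      by rewrite (le_trans (ltW x00) xz) (le_trans zx).
    move: gg; rewrite ler_norml => /andP[_ gg].
    have : C * `|x - x0| <= C * d ^+ 2 by rewrite ler_wpM2l// ltW.
    by lra.
  rewrite ip_scalel//; last exact: L2_cst.
  have Cd : 0 <= C * d ^+ 2 by apply: mulr_ge0; exact: ltW.
  rewrite ler_wpM2l//.
  have := @bump_int_le (d ^+ 2) x0 d20.
  rewrite r1E -!exprM; apply; first exact: le_trans wx0.
  exact: le_trans wx1.
have M1E : A t1 * d ^+ 15 = 1.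
  have -> : A t1 = M1 by rewrite /A /M1 r1E -exprM.
  rewrite -[X in _ * X ^+ _](lnK (x := d)) ?posrE// -expRM_natl -expRD.
  rewrite lnXn//.
  have -> : - (15 / 4) * (ln d *+ 4) + 15 * ln d = 0.
    by rewrite -[ln d *+ 4]mulr_natr; field.
  by rewrite expR0.
have At1 : 0 <= A t1 by exact: expR_ge0.
have fin : A t1 * (C * d ^+ 2 * ((d ^+ 4) ^+ 3 * (2 * d ^+ 2))) = 2 * C * d.
  have -> : A t1 * (C * d ^+ 2 * ((d ^+ 4) ^+ 3 * (2 * d ^+ 2))) =
    2 * C * d * (A t1 * d ^+ 15) by ring.
  by rewrite M1E mulr1.
have : m <= 2 * C * d.
  by rewrite -fin (le_trans lhs)// (le_trans H)// ler_wpM2l.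
have : d * (4 * C) <= m by rewrite -ler_pdivlMr// mulr_gt0.
by lra.
Qed.

End StrongMaximumPrinciple.

(** * The linear flow *)

Section LinearFlow.
Variable R : realType.
Local Notation mu := (@lebesgue_measure R).
Local Notation I := (@I01 R).
Local Notation Rint := (@Defs.Rint R).

(* Picone's identity with q = psi' / psi, psi = cos (sqrt l (x - 1/2)), which is
   positive on [0, 1] because l < pi^2; q' = - l - q^2. *)
Lemma poincare (l : R) (g g1 g2 : R -> R) : 0 < l -> l < pi ^+ 2 ->
  prim g g1 -> prim g1 g2 -> g 0 = 0 -> g 1 = 0 ->
  ip g2 g <= - l * ip g g.
Proof.
move=> l0 lpi pg pg1 g0 g10.
pose s := Num.sqrt l.
have s0 : 0 < s by rewrite sqrtr_gt0.
have s2 : s ^+ 2 = l by rewrite sqr_sqrtr// ltW.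
have spi : s < pi.
  have -> : (pi : R) = Num.sqrt (pi ^+ 2) by rewrite sqrtr_sqr ger0_norm// pi_ge0.
  by rewrite ltr_sqrt// exprn_gt0// pi_gt0.
have ct (x : R) : 0 <= x <= 1 -> 0 < cos (s * (x - 1 / 2)).
  by move=> /andP[x0 x1]; apply: cos_gt0_pihalf; apply/andP; split; nra.
pose q (x : R) := - s * tan (s * (x - 1 / 2)).
have dq (x : R) : 0 <= x <= 1 -> is_derive x 1 q (- l - q x ^+ 2).
  move=> x01; have c0 : cos (s * (x - 1 / 2)) != 0 by rewrite gt_eqF// ct.
  have H1 : is_derive x 1 (fun x => s * (x - 1 / 2)) s.
    apply: (@quad_is_derive _ _ _ _ 0) => h _.
    have -> : s * (x + h - 1 / 2) - s * (x - 1 / 2) - s * h = 0 by ring.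
    by rewrite normr0 mul0r.
  have H2 := @is_derive1_comp _ tan (fun x => s * (x - 1 / 2)) x _ _ (is_derive_tan c0) H1.
  have H3 : is_derive (tan (s * (x - 1 / 2))) 1 (fun y : R => - s * y) (- s).
    apply: (@quad_is_derive _ _ _ _ 0) => h _.
    set y := tan _; have -> : - s * (y + h) - - s * y - - s * h = 0 by ring.
    by rewrite normr0 mul0r.
  have H4 := @is_derive1_comp _ (fun y : R => - s * y)
    (tan \o (fun x => s * (x - 1 / 2))) x _ _ H3 H2.
  by apply: (is_derive_eq H4); rewrite cos2_tan2// /q -s2; ring.
have cq (x : R) : 0 <= x <= 1 -> {for x, continuous q}.
  by move=> /dq; exact: is_derive1_continuous.
have pq : prim q (fun x => - l - q x ^+ 2).
  apply: C1_prim => // x x01.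
  apply: (@continuousB _ _ _ (fun _ => - l) (fun x => q x ^+ 2)).
    exact: cst_continuous.
  by apply: (@continuousM _ _ q q); exact: cq.
have [Bq hBq] := prim_bounded pq.
have [C1 hC1] := prim_bounded pg1.
have q'b x : I x -> `|- l - q x ^+ 2| <= l + Bq ^+ 2.
  move=> Ix; rewrite (le_trans (ler_normB _ _))// normrN (ger0_norm (ltW l0)) lerD2l.
  by rewrite normrX lerXn2r ?nnegrE// ?hBq// (le_trans _ (hBq x Ix)).
have p1 := prim_mul pq pg q'b.
have p2 := prim_mul pg p1 hC1.
have p3 := prim_mul pg pg1 hC1.
have [_ /(_ 1)] := prim_sub p3 p2; rewrite lexx ler01 => /(_ isT).
rewrite g0 g10 !mul0r subrr add0r => /esym.
(* The derivative of g (g1 - q g) is w^2 + (l g + g2) g, and its integral is zero by the boundary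
   values of g. *)
set w := fun x => g1 x - q x * g x.
have Lqg := prim_L2 p1.
have Lg := prim_L2 pg; have Lg1 := prim_L2 pg1; have [Lg2 _] := pg1.
have Lw : L2 w by exact: L2_sub.
have Llg := L2_add (L2_scale l Lg) Lg2.
rewrite (@Rint_eq _ _ _ _ (fun x => w x * w x + (l * g x + g2 x) * g x)); last first.
  by move=> z _; rewrite /w; ring.
rewrite -[Rint _ _ _]/(\int[mu]_(x in I) (w x * w x + (l * g x + g2 x) * g x)).
rewrite RintegralD; [|exact: measurable_I01|exact: L2_mul_int|exact: L2_mul_int].
rewrite -/(ip w w) -/(ip (fun x => l * g x + g2 x) g).
rewrite (ip_addl (L2_scale l Lg) Lg2 Lg) (ip_scalel l Lg Lg).
by have := ip_ge0 w; lra.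
Qed.

(** Nothing is asked at [tau] itself: initial data are only reached as limits. *)
Definition linflow (b omega tau : R) (u : R -> R -> R) :=
  [/\ forall t, tau < t -> L2 (u t),
      forall T1 T2, tau < T1 -> T1 <= T2 -> acH T1 T2 u &
      {ae mu, forall t : R, tau < t -> exists d g g1 g2,
        [/\ derivL2 u t d, prim g g1, prim g1 g2, g 0 = 0 /\ g 1 = 0 &
            eqH (u t) g /\ eqH d (fun x => g2 x + (b + omega * u t x))]}].

Lemma abs_contR_sublinear (T1 T2 k : R) (N : R -> R) : abs_contR T1 T2 N ->
  abs_contR T1 T2 (fun r => - N r - k * r).
Proof.
move=> acN.
have aci : abs_contR T1 T2 id.
  by apply: (@lipschitz_abs_contR _ _ _ _ 1) => // s t _ st _; rewrite mul1r ger0_norm// subr_ge0.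
apply: (@abs_contR_dominated _ _ _ (1 + `|k|) _ _ _ acN aci); first by rewrite addr_ge0.
move=> [s t] /= _ _ _.
have -> : - N t - k * t - (- N s - k * s) = - (N t - N s) - k * (t - s) by ring.
rewrite (le_trans (ler_normB _ _))// normrN normrM.
have := normr_ge0 k; have := normr_ge0 (N t - N s); have := normr_ge0 (t - s); nra.
Qed.

(** The source b cancels in the difference, so the Poincare inequality gives N' <= - (pi^2 - omega)
    N. As N decreases, it stays above N t on [s, t], and integrating this constant bound replaces
    Gronwall's lemma. *)
Lemma linflow_contraction (b omega tau : R) (u z : R -> R -> R) :
  0 <= omega -> omega < pi ^+ 2 ->
  linflow b omega tau u -> linflow b omega tau z ->
  let N t := ip (fun x => u t x - z t x) (fun x => u t x - z t x) in
  forall s t, tau < s -> s <= t ->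
    N t <= N s /\ N t * (1 + (pi ^+ 2 - omega) * (t - s)) <= N s.
Proof.
move=> om0 ompi [Lu acu aeu] [Lz acz aez] N s t taus st.
(* The midpoint: strictly below pi^2, and 2 (l - omega) = pi^2 - omega. *)
pose l := (omega + pi ^+ 2) / 2.
have l0 : 0 < l by rewrite /l; lra.
have lpi : l < pi ^+ 2 by rewrite /l; lra.
pose w (t : R) := fun x : R => u t x - z t x.
have Lw r : tau < r -> L2 (w r) by move=> tr; apply: L2_sub; [exact: Lu|exact: Lz].
(* Used twice: c = 0 yields monotonicity, which then justifies c = N t. *)
have key s' t' c : tau < s' -> s' <= t' -> 0 <= c ->
    (forall r, s' <= r <= t' -> c <= N r) ->
    N t' + (pi ^+ 2 - omega) * c * (t' - s') <= N s'.
  move=> taus' st' c0 cN.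
  have ps r : s' <= r <= t' -> tau < r by move=> /andP[+ _]; exact: lt_le_trans.
  have acw : acH s' t' w.
    apply: acH_sub; [|exact: acu| |exact: acz].
      by move=> r /ps; exact: Lu.
    by move=> r /ps; exact: Lz.
  have acN : abs_contR s' t' N.
    by apply: ip_abs_contR => // r /ps; exact: Lw.
  pose k := (pi ^+ 2 - omega) * c.
  suff : - N s' - k * s' <= - N t' - k * t' by rewrite /k; lra.
  apply: (@abs_cont_nondecreasing _ s' t' (fun r => - N r - k * r)) => //.
    exact: abs_contR_sublinear.
  apply: aeS2 aeu aez => r Hu Hz rT; have tr := ps r rT.
  have [d [g [g1 [g2 [du pg pg1 [g0 g10] [ug dE]]]]]] := Hu tr.
  have [d' [f [f1 [f2 [dz pf pf1 [f0 f10] [zf dE']]]]]] := Hz tr.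
  have dw := derivL2_sub tr Lu Lz du dz.
  have dN := ip_is_derive tr Lw Lw dw dw.
  set dd := fun x => d x - d' x in dw dN.
  exists (- (ip dd (w r) + ip (w r) dd) - k); last first.
    apply/is_derive_eps => e e0; have /is_derive_eps/(_ e e0)[de de0 H] := dN.
    exists de => // h hd.
    have -> : - N (r + h) - k * (r + h) - (- N r - k * r) -
        (- (ip dd (w r) + ip (w r) dd) - k) * h =
        - (N (r + h) - N r - (ip dd (w r) + ip (w r) dd) * h) by ring.
    by rewrite normrN; exact: H.
  have [Lg2 _] := pg1; have [Lf2 _] := pf1.
  have pG := prim_sub pg pf; have pG1 := prim_sub pg1 pf1.
  have LG := prim_L2 pG; have LG2 := L2_sub Lg2 Lf2; have Lwr := Lw r tr.
  have [Ldd _] := dw.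
  have wG : eqH (w r) (fun x => g x - f x).
    by apply: aeS2 ug zf => x + + xI; rewrite /w => -> // ->.
  have ddE : eqH dd (fun x => (g2 x - f2 x) + omega * w r x).
    by apply: aeS2 dE dE' => x + + xI; rewrite /dd /w => -> // -> //; ring.
  have E1 : ip dd (w r) = ip (fun x => g2 x - f2 x) (fun x => g x - f x) + omega * N r.
    rewrite (@ip_eqH _ dd _ (w r) (w r) Ldd _ Lwr Lwr ddE); last 2 first.
    - by apply: L2_add => //; exact: L2_scale.
    - exact: aeW.
    rewrite ip_addl//; last exact: L2_scale.
    rewrite ip_scalel//; congr (_ + _).
    by apply: ip_eqH => //; exact: aeW.
  have E2 : N r = ip (fun x => g x - f x) (fun x => g x - f x) by exact: ip_eqH.
  have := poincare l0 lpi pG pG1.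
  rewrite g0 g10 f0 f10 subrr => /(_ erefl erefl).
  rewrite -E2 => pc.
  rewrite (ipC (w r)) E1; have := cN r rT; rewrite /k /l in pc *.
  by have : 0 < pi ^+ 2 - omega; [lra|nra].
have mono r : s <= r <= t -> N t <= N r.
  move=> /andP[sr rt]; have := key r t 0 (lt_le_trans taus sr) rt (lexx _).
  rewrite mulr0 mul0r addr0; apply => r' _; exact: ip_ge0.
split; first by apply: mono; rewrite lexx st.
have := key s t (N t) taus st (ip_ge0 _) mono; lra.
Qed.

Lemma linflow_stationary (b omega : R) (v v1 : R -> R) :
  prim v v1 -> prim v1 (fun x => - (b + omega * v x)) -> v 0 = 0 -> v 1 = 0 ->
  forall tau, linflow b omega tau (fun _ => v).
Proof.
move=> pv pv1 v0 v10 tau; have Lv := prim_L2 pv.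
have z0 : normH (fun x => v x - v x) = 0.
  apply/eqP; rewrite eq_le normH_ge0 andbT; apply: normH_bound => //.
    exact: L2_sub.
  by move=> x _; rewrite subrr normr0.
split => // [T1 T2 _ _|].
  apply: (@lipschitz_acH _ _ _ _ 0) => // s t _ _ _.
  by rewrite z0 mul0r.
apply: aeW => t _; exists (fun _ => 0), v, v1, (fun x => - (b + omega * v x)).
split => //.
  split; first exact: L2_cst.
  move=> e e0; exists 1 => // h _.
  rewrite (_ : (fun x => _) = (fun x => v x - v x)).
    by rewrite z0 mulr_ge0// ltW.
  by apply/funext => x; rewrite mulr0 subr0.
split; first exact: aeW.
by apply: aeW => x _; rewrite addNr.
Qed.

Lemma v1plus_exists (b omega : R) : 0 < b -> 0 <= omega -> omega < pi ^+ 2 ->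
  exists v, is_v1plus b omega v /\ L2 v /\ forall tau, linflow b omega tau (fun _ => v).
Proof.
move=> b0 om0 ompi.
suff [v [v1 [vp v0 v10 pv pv1]]] : exists v v1, [/\ forall x : R, 0 < x < 1 -> 0 < v x,
    v 0 = 0, v 1 = 0, prim v v1 & prim v1 (fun x => - (b + omega * v x))].
  exists v; split; last by split; [exact: prim_L2 pv|exact: linflow_stationary pv1 _ _].
  split => //; split => //; split => //; exists v1, (fun x => - (b + omega * v x)).
  have [L E] := pv1; have [_ E'] := pv; have [m n] := L.
  split; first by exists (fun x => - (b + omega * v x)); split => //; split => //; exact: aeW.
  by split => //; split => //; split => //; apply: aeW => x _; rewrite opprK.
(* The trigonometric formula used for omega > 0 degenerates here to its limit, a parabola. *)
have [om|om] := eqVneq omega 0.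
  exists (fun x => b / 2 * (x * (1 - x))), (fun x => b / 2 * (1 - 2 * x)); split.
  - by move=> x /andP[x0 x1]; rewrite !mulr_gt0// ?subr_gt0// divr_gt0.
  - by rewrite mul0r mulr0.
  - by rewrite subrr mulr0 mulr0.
  - apply: C1_prim => x _; last first.
      apply: (@is_derive1_continuous _ _ _ (- b)).
      apply: (@quad_is_derive _ _ _ _ 0) => h _.
      set y := (X in `|X|); have -> : y = 0 by rewrite /y; field.
      by rewrite normr0 mul0r.
    apply: (@quad_is_derive _ _ _ _ (b / 2)) => h _.
    set y := (X in `|X|); have -> : y = - (b / 2 * h ^+ 2) by rewrite /y; field.
    by rewrite normrN ger0_norm// mulr_ge0 ?sqr_ge0// divr_ge0// ltW.
  - rewrite om; apply: (@prim_ext _ (fun x => b / 2 * (1 - 2 * x)) _ (fun _ => - b)) => //.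
    + apply: C1_prim => x _; last exact: cst_continuous.
      apply: (@quad_is_derive _ _ _ _ 0) => h _.
      set y := (X in `|X|); have -> : y = 0 by rewrite /y; field.
      by rewrite normr0 mul0r.
    + by move=> x _; rewrite mul0r addr0.
    + rewrite (_ : (fun x => _) = (fun _ => - b)); first exact: L2_cst.
      by apply/funext => x; rewrite mul0r addr0.
have omp : 0 < omega by rewrite lt_neqAle eq_sym om.
pose s := Num.sqrt omega.
have s0 : 0 < s by rewrite sqrtr_gt0.
have s2 : s ^+ 2 = omega by rewrite sqr_sqrtr.
have spi : s < pi.
  have -> : (pi : R) = Num.sqrt (pi ^+ 2) by rewrite sqrtr_sqr ger0_norm// pi_ge0.
  by rewrite ltr_sqrt// exprn_gt0// pi_gt0.
have c0 : 0 < cos (s / 2) by apply: cos_gt0_pihalf; apply/andP; split; lra.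
have cn0 : cos (s / 2) != 0 by rewrite gt_eqF.
(* The amplitude for which k cos (s (x - 1/2)) - b / omega vanishes at both ends; s < pi keeps cos
   (s / 2) positive. *)
pose k := b / (omega * cos (s / 2)).
have k0 : 0 < k by rewrite divr_gt0// mulr_gt0.
pose th (x : R) := s * (x - 1 / 2).
have dth (x : R) : is_derive x 1 th s.
  apply: (@quad_is_derive _ _ _ _ 0) => h _.
  have -> : th (x + h) - th x - s * h = 0 by rewrite /th; ring.
  by rewrite normr0 mul0r.
have dlin (a e y : R) : is_derive y 1 (fun y : R => a * y + e) a.
  apply: (@quad_is_derive _ _ _ _ 0) => h _.
  have -> : a * (y + h) + e - (a * y + e) - a * h = 0 by ring.
  by rewrite normr0 mul0r.
have dc (x : R) : is_derive x 1 (fun x => k * cos (th x) + - (b / omega)) (- k * s * sin (th x)).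
  have H1 := @is_derive1_comp _ cos th x _ _ (is_derive_cos _) (dth x).
  have H2 := @is_derive1_comp _ (fun y => k * y + - (b / omega)) (cos \o th) x _ _ (dlin _ _ _) H1.
  by apply: (is_derive_eq H2); ring.
have dsn (x : R) : is_derive x 1 (fun x => - k * s * sin (th x)) (- k * omega * cos (th x)).
  have H1 := @is_derive1_comp _ sin th x _ _ (is_derive_sin _) (dth x).
  have H2 := @is_derive1_comp _ (fun y => - k * s * y + 0) (sin \o th) x _ _ (dlin _ _ _) H1.
  have E : (fun x : R => - k * s * sin (th x)) =
      (fun y : R => - k * s * y + 0) \o (sin \o th).
    by apply/funext => y /=; rewrite addr0.
  by rewrite E; apply: (is_derive_eq H2); rewrite -s2; ring.
have cc (x : R) : {for x, continuous (fun x => - k * omega * cos (th x))}.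
  have H1 := @is_derive1_comp _ cos th x _ _ (is_derive_cos _) (dth x).
  have H2 := @is_derive1_comp _ (fun y => - k * omega * y + 0) (cos \o th) x _ _ (dlin _ _ _) H1.
  have E : (fun x : R => - k * omega * cos (th x)) =
      (fun y : R => - k * omega * y + 0) \o (cos \o th).
    by apply/funext => y /=; rewrite addr0.
  by rewrite E; exact: is_derive1_continuous H2.
have vE (x : R) : - (b + omega * (k * cos (th x) + - (b / omega))) = - k * omega * cos (th x).
  by field; rewrite gt_eqF.
have kc : k * cos (s / 2) = b / omega by rewrite /k; field; rewrite cn0 gt_eqF.
exists (fun x => k * cos (th x) + - (b / omega)), (fun x => - k * s * sin (th x)); split.
- move=> x /andP[x0 x1]; rewrite -kc.
  (* Positivity follows from cos (p - q) - cos (p + q) = 2 sin p sin q. *)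
  have -> : th x = s * x / 2 - s * (1 - x) / 2 by rewrite /th; field.
  have -> : s / 2 = s * x / 2 + s * (1 - x) / 2 by field.
  rewrite cosB cosD.
  have S1 : 0 < sin (s * x / 2) by apply: sin_gt0_pi; apply/andP; split; nra.
  have S2 : 0 < sin (s * (1 - x) / 2) by apply: sin_gt0_pi; apply/andP; split; nra.
  have S3 : 0 < k * (sin (s * x / 2) * sin (s * (1 - x) / 2)).
    by rewrite mulr_gt0// mulr_gt0.
  by lra.
- have -> : th 0 = - (s / 2) by rewrite /th; field.
  by rewrite cosN kc subrr.
- have -> : th 1 = s / 2 by rewrite /th; field.
  by rewrite kc subrr.
- by apply: C1_prim => x _; exact: is_derive1_continuous (dsn x).
- rewrite (_ : (fun x => - (b + _)) = (fun x => - k * omega * cos (th x))).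
    by apply: C1_prim => x _; exact: cc.
  by apply/funext => x; exact: vE.
Qed.

End LinearFlow.

(** * Solutions in terms of measurable representatives *)

Section Translation.
Variable R : realType.
Local Notation mu := (@lebesgue_measure R).
Local Notation I := (@I01 R).

Lemma inH_measurable_L2 (f : R -> R) : inH f -> measurable_fun I f -> L2 f.
Proof.
by move=> [g [mg [fg gi]]] mf; split => //; rewrite (normH2_eqH fg).
Qed.

Lemma normH2_lt_normH (f : R -> R) (e : R) : L2 f -> 0 < e ->
  (normH2 f < (e ^+ 2)%:E)%E -> normH f <= e.
Proof.
move=> Lf e0; rewrite normH2E// lte_fin => H.
by rewrite -ler_sqr ?nnegrE ?normH_ge0 ?(ltW e0)// normH_sqr// ltW.
Qed.

Lemma abs_contH_eqH (T1 T2 : R) (u U : R -> R -> R) :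
  (forall t, T1 <= t -> eqH (u t) (U t)) ->
  abs_contH T1 T2 u -> abs_contH T1 T2 U.
Proof.
move=> uU H e e0; have [d [d0 Hd]] := H e e0.
exists d; split => // n a b ab ba lt; apply: le_lt_trans (Hd n a b ab ba lt).
rewrite le_eqVlt; apply/orP; left; apply/eqP; apply: eq_bigr => i _.
have [a1 [a2 a3]] := ab i (ltn_ord i).
apply/esym/normH_eqH.
by apply: aeS2 (uU _ a1) (uU _ (le_trans a1 a2)) => x + + xI => -> // ->.
Qed.

Lemma derivH_derivL2 (tau t : R) (u U : R -> R -> R) (d d0 : R -> R) :
  tau < t -> (forall s, tau < s -> eqH (u s) (U s)) ->
  (forall s, tau < s -> L2 (U s)) -> eqH d d0 -> L2 d0 ->
  derivH_at tau u t d -> derivL2 U t d0.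
Proof.
move=> taut uU LU dd Ld [_ H]; split => // e e0.
have [de [de0 Hd]] := H (e ^+ 2) (exprn_gt0 2 e0).
exists (Num.min de (t - tau)); first by rewrite lt_min de0 subr_gt0.
move=> h; rewrite lt_min => /andP[hde ht].
have th : tau < t + h by move: ht; rewrite ltr_norml => /andP[]; lra.
have LUt := LU _ taut; have LUh := LU _ th.
have [->|h0] := eqVneq h 0.
  rewrite normr0 mulr0 addr0; apply: normH_bound => //.
    by apply: L2_sub; [exact: L2_sub|exact: L2_scale].
  by move=> x _; rewrite subrr mul0r subrr normr0.
pose Q x := h^-1 * (U (t + h) x - U t x) - d0 x.
have LQ : L2 Q by apply: L2_sub => //; apply: L2_scale; exact: L2_sub.
have QE : eqH (fun x => (u (t + h) x - u t x) / h - d x) Q.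
  have uh := uU _ th; have ut := uU _ taut.
  have H1 : {ae mu, forall x : R, x \in I -> u (t + h) x - u t x = U (t + h) x - U t x}.
    by apply: aeS2 uh ut => x + + xI => -> // ->.
  by apply: aeS2 H1 dd => x + + xI => -> // -> //; rewrite /Q mulrC.
have := Hd h h0 hde th; rewrite (normH2_eqH QE) => /(normH2_lt_normH LQ e0) Qe.
rewrite (_ : (fun x => _) = (fun x => h * Q x)).
  by rewrite normH_scale// mulrC ler_wpM2r.
by apply/funext => x; rewrite /Q; field.
Qed.

Lemma inDA_prim (f g2 : R -> R) : inDA_with f g2 ->
  exists g g1, [/\ prim g g1, prim g1 g2, g 0 = 0 /\ g 1 = 0 & eqH f g].
Proof.
move=> [ig2 [mg2 [g [g1 [fg [g0 [g10 [E1 E2]]]]]]]].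
have p1 : prim g1 g2 by split => //; exact: inH_measurable_L2.
by exists g, g1; split => //; split => //; exact: prim_L2 p1.
Qed.

Lemma normH_mono (f g : R -> R) : L2 f -> L2 g ->
  (forall x, I x -> `|f x| <= `|g x|) -> normH f <= normH g.
Proof.
move=> Lf Lg fg; rewrite !normHE//; apply: ler_wsqrtr; apply: le_Rintegral.
- exact: measurable_I01.
- exact: L2_mul_int.
- exact: L2_mul_int.
- move=> x Ix; rewrite -!expr2 -[f x ^+ 2]real_normK ?num_real//.
  by rewrite -[g x ^+ 2]real_normK ?num_real// lerXn2r ?nnegrE// fg.
Qed.

(* At a zero of the nonnegative [U t], the difference quotients are nonnegative
   for h > 0 and nonpositive for h < 0. *)
Lemma deriv_zero (tau t : R) (U : R -> R -> R) (d : R -> R) :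
  tau < t -> (forall s, tau < s -> L2 (U s)) ->
  (forall s x, tau < s -> 0 <= U s x) -> derivL2 U t d ->
  {ae mu, forall x : R, x \in I -> U t x = 0 -> d x = 0}.
Proof.
move=> taut LU U0 [Ld Hd].
have LUt := LU _ taut.
pose Z := I `&` (U t @^-1` [set 0]).
have mZ : measurable Z.
  by case: LUt => mU _; exact: mU (@measurable_I01 R) _ (measurable_set1 0).
(* The part of [d] on the zero set having the sign forbidden by the quotients with increments of
   sign [sg]. Where it is nonzero, h times it is at most the differentiation error, so its norm is
   below every e. *)
pose f (sg : R) (x : R) := \1_Z x * pos (- (sg * d x)).
have Lf sg : L2 (f sg).
  apply: (@L2_bounded_mul _ _ _ 1).
  - have [md _] := Ld; have [ms ns] := L2_scale sg Ld; split.
      apply: measurableT_comp.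
        apply: continuous_measurable_fun; exact: pos_continuous.
      exact: measurableT_comp.
    apply: le_lt_trans ns; apply: ge0_le_integral.
    + exact: measurable_I01.
    + by move=> x _; rewrite lee_fin sqr_ge0.
    + apply/measurable_EFinP; apply: measurable_funX; apply: measurableT_comp.
        apply: continuous_measurable_fun; exact: pos_continuous.
      exact: measurableT_comp.
    + by apply/measurable_EFinP; exact: measurable_funX.
    + move=> x _; rewrite lee_fin -[leRHS]real_normK ?num_real//.
      by rewrite lerXn2r ?nnegrE ?pos_ge0// (le_trans (pos_le _))// normrN.
  - by apply: measurable_funTS; exact: measurable_indic.
  - by move=> x _; rewrite indicE; case: (_ \in _); rewrite ?normr1 ?normr0.
have f0 sg : `|sg| = 1 -> normH (f sg) = 0.
  move=> sg1; apply/eqP; rewrite eq_le normH_ge0 andbT; apply/ler_addgt0Pr => e e0.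
  rewrite add0r; have [de de0 He] := Hd e e0.
  pose h := Num.min (de / 2) ((t - tau) / 2).
  have h0 : 0 < h by rewrite lt_min !divr_gt0// subr_gt0.
  have hd : h < de by rewrite (@le_lt_trans _ _ (de / 2))//; [rewrite ge_min lexx|lra].
  have ht : h < t - tau.
    by rewrite (@le_lt_trans _ _ ((t - tau) / 2))//; [rewrite ge_min lexx orbT|lra].
  have nh : `|sg * h| = h by rewrite normrM sg1 mul1r ger0_norm// ltW.
  have th : tau < t + sg * h.
    by have := ler_norm (- (sg * h)); rewrite normrN nh; lra.
  have := He (sg * h); rewrite nh => /(_ hd) K.
  have : normH (fun x => h * f sg x) <= e * h.
    apply: le_trans K; apply: normH_mono.
    - exact: L2_scale.
    - by apply: L2_sub; [apply: L2_sub; exact: LU|exact: L2_scale].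
    move=> x Ix; rewrite /f indicE; case: (boolP (x \in Z)) => [|_]; last first.
      by rewrite mul0r mulr0 normr0.
    rewrite inE => -[_ /= ->]; rewrite mul1r subr0.
    have Uh := U0 _ x th.
    rewrite ger0_norm ?mulr_ge0 ?pos_ge0 ?(ltW h0)//.
    rewrite /pos; case: ifP => sd; last by rewrite mulr0.
    apply: le_trans (ler_norm _).
    have -> : h * - (sg * d x) = - (sg * h * d x) by ring.
    by lra.
  by rewrite normH_scale// ger0_norm ?(ltW h0)// mulrC ler_pM2r.
have g0 sg : `|sg| = 1 -> eqH (f sg) (fun _ => 0).
  by move=> sg1; apply: normH0_eqH => //; rewrite -normH_sqr// f0// expr0n.
have g1 : eqH (f 1) (fun _ => 0) by apply: g0; rewrite normr1.
have g2 : eqH (f (-1)) (fun _ => 0) by apply: g0; rewrite normrN normr1.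
apply: aeS2 g1 g2 => x + + xI Ux => /(_ xI) + /(_ xI).
have xZ : x \in Z by rewrite inE; split => //; exact: set_mem xI.
rewrite /f indicE xZ !mul1r mulN1r opprK /pos.
by case: (lerP 0 (- d x)); case: (lerP 0 (d x)); lra.
Qed.

Lemma solution_data (tau : R) (u0 : R -> R) (u U : R -> R -> R)
    (rhs : (R -> R -> R) -> Prop) :
  (forall t, tau < t -> eqH (u t) (U t)) -> (forall t, tau < t -> L2 (U t)) ->
  is_solution_with tau u0 u rhs ->
  (forall T1 T2, tau < T1 -> T1 <= T2 -> acH T1 T2 U) /\
  exists r, [/\ L2locH tau r, rhs r &
    {ae mu, forall t : R, tau < t -> exists d g g1 g2,
      [/\ derivL2 U t d, prim g g1, prim g1 g2, g 0 = 0 /\ g 1 = 0 &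
          eqH (U t) g /\ eqH (fun x => d x - g2 x) (r t)]}].
Proof.
move=> uU LU [_ [_ [_ [ac [r [Lr [rr Hr]]]]]]]; split.
  (* A solution is absolutely continuous on [T1, T2] only for T1 < T2; the degenerate interval is
     treated apart. *)
  move=> T1 T2 tT1; rewrite le_eqVlt => /orP[/eqP <-|T12].
    apply: (@lipschitz_acH _ _ _ _ 0) => // s t T1s st tT1'.
    have -> : t = s by apply/eqP; rewrite eq_le st (le_trans tT1').
    rewrite mul0r; apply: normH_bound => //.
      by apply: L2_sub; apply: LU; exact: lt_le_trans T1s.
    by move=> x _; rewrite subrr normr0.
  apply: abs_contH_acH; apply: abs_contH_eqH (ac T1 T2 tT1 T12) => t T1t.
  by apply: uU; exact: lt_le_trans T1t.
exists r; split => //; apply: aeS Hr => t Ht taut.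
have [d [g2 [DA [dd E]]]] := Ht taut.
have [[d0 [md0 [dd0 nd0]]] _] := dd.
have Ld0 : L2 d0 by [].
have [g [g1 [pg pg1 g01 ug]]] := inDA_prim DA.
exists d0, g, g1, g2; split => //.
  exact: derivH_derivL2 dd0 Ld0 dd.
split; first exact: eqH_trans (eqH_sym (uU _ taut)) ug.
by apply: aeS2 dd0 E => x + + xI => <- // ->.
Qed.

Lemma lin_linflow (b omega tau : R) (u0 : R -> R) (u U : R -> R -> R) :
  (forall t, tau < t -> eqH (u t) (U t)) -> (forall t, tau < t -> L2 (U t)) ->
  is_solution_lin b omega tau u0 u -> linflow b omega tau U.
Proof.
move=> uU LU /(solution_data uU LU)[acU [r [_ rr Hr]]]; split => //.
apply: aeS2 Hr rr => t Ht rt taut.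
have [d [g [g1 [g2 [dU pg pg1 g01 [Ug E]]]]]] := Ht taut.
exists d, g, g1, g2; split => //; split => //.
have rt' := rt taut.
have H : {ae mu, forall x : R, x \in I -> d x - g2 x = b + omega * u t x}.
  by apply: aeS2 E rt' => x + + xI => -> // ->.
apply: aeS2 H (uU _ taut) => x + + xI => /(_ xI) H1 /(_ xI) <-.
by rewrite -H1; ring.
Qed.

Lemma P_superflow (b omega tau : R) (u U r : R -> R -> R) :
  0 < b -> 0 <= omega ->
  (forall t, tau < t -> eqH (u t) (U t)) -> (forall t, tau < t -> L2 (U t)) ->
  (forall t x, tau < t -> 0 <= U t x) ->
  (forall T1 T2, tau < T1 -> T1 <= T2 -> acH T1 T2 U) ->
  {ae mu, forall t, tau < t -> {ae mu, forall x, x \in I ->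
     exists y, H0 (u t x) y /\ r t x = b * y + omega * u t x}} ->
  {ae mu, forall t : R, tau < t -> exists d g g1 g2,
      [/\ derivL2 U t d, prim g g1, prim g1 g2, g 0 = 0 /\ g 1 = 0 &
          eqH (U t) g /\ eqH (fun x => d x - g2 x) (r t)]} ->
  superflow tau U.
Proof.
move=> b0 om0 uU LU U0 acU rr Hr; split => //.
apply: aeS2 rr Hr => t rt Ht taut.
have [d [g [g1 [g2 [dU pg pg1 g01 [Ug E]]]]]] := Ht taut.
exists d, g, g1, g2; split => //; split => //.
have Z1 := deriv_zero taut LU U0 dU.
(* Applied twice: g1 vanishes almost everywhere on the zeros of g, and g2 almost everywhere on those
   of g1. *)
have Z2 := prim_zero pg; have Z3 := prim_zero pg1.
have H1 : {ae mu, forall x : R, x \in I -> U t x = 0 -> d x = 0 /\ g2 x = 0}.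
  have Z23 : {ae mu, forall x : R, x \in I -> g x = 0 -> g2 x = 0}.
    by apply: aeS2 Z2 Z3 => x K1 K2 xI gx; apply: K2 => //; exact: K1.
  have Z24 : {ae mu, forall x : R, x \in I -> U t x = 0 -> g2 x = 0}.
    by apply: aeS2 Z23 Ug => x K1 K2 xI; rewrite K2//; exact: K1.
  by apply: aeS2 Z1 Z24 => x K1 K2 xI Ux; split; [exact: K1|exact: K2].
have H2 : {ae mu, forall x : R, x \in I -> 0 < U t x -> d x - g2 x = b + omega * U t x}.
  have K1 : {ae mu, forall x : R, x \in I -> 0 < U t x -> r t x = b + omega * U t x}.
    apply: aeS2 (rt taut) (uU _ taut) => x K1 K2 xI.
    have [y [Hy ->]] := K1 xI; rewrite -K2// => ux.
    case: Hy => [[]|[[]|[]]]; [lra|lra|].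
    by move=> _ ->; rewrite mulr1.
  by apply: aeS2 K1 E => x + + xI Ux => <- // ->.
apply: aeS2 H1 H2 => x K1 K2 xI.
have := U0 t x taut; rewrite le_eqVlt => /orP[/eqP Ux|Ux].
  by have [-> ->] := K1 xI (esym Ux).
have := K2 xI Ux; have : 0 <= omega * U t x by rewrite mulr_ge0// ltW.
by lra.
Qed.

(** On [0, 1] this bump is (x (1 - x))^3, positive in the interior, so it detects every nonzero
    nonnegative function. *)
Lemma bump_pos_neq0 (U : R -> R) : L2 U -> (forall x, 0 <= U x) ->
  ~ eqH U (fun _ => 0) -> 0 < ip U (bump (1 / 4) (1 / 2)).
Proof.
move=> LU U0 nU.
have Lb : L2 (bump (1 / 4) (1 / 2) : R -> R) by exact: prim_L2 (prim_bump _ _).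
have Ub x : 0 <= U x * bump (1 / 4) (1 / 2) x by rewrite mulr_ge0// bump_ge0.
rewrite lt_neqAle; apply/andP; split; last by apply: Rintegral_ge0 => x _; exact: Ub.
apply/eqP => /esym i0; apply: nU.
have H := ip0_eqH LU Lb (fun x _ => Ub x) i0.
apply: aeS2 H (ae_interior R) => x K xint xI.
have /andP[xp xl] := xint xI.
have /eqP := K xI; rewrite mulf_eq0 => /orP[/eqP //|].
have P0 : 0 < 1 / 4 - (x - 1 / 2) ^+ 2.
  have -> : 1 / 4 - (x - 1 / 2) ^+ 2 = x * (1 - x) by field.
  by rewrite mulr_gt0// subr_gt0.
by rewrite /bump pos_id ?ltW// expf_eq0/= gt_eqF.
Qed.

End Translation.

(** * Complete trajectories *)

Section Trajectories.
Variable R : realType.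
Local Notation mu := (@lebesgue_measure R).
Local Notation I := (@I01 R).

Lemma continuousH_small (tau : R) (u V : R -> R -> R) :
  (forall t, tau <= t -> eqH (u t) (V t)) -> (forall t, tau <= t -> L2 (V t)) ->
  continuousH_from tau u -> eqH (u tau) (fun _ => 0) ->
  forall e : R, 0 < e -> exists2 d : R, 0 < d &
    forall s, tau < s -> s < tau + d -> normH (V s) <= e.
Proof.
move=> uV LV cu u0 e e0.
have [d [d0 H]] := cu tau (lexx _) (e ^+ 2) (exprn_gt0 2 e0).
exists d => // s taus sd; apply: normH2_lt_normH => //; first exact: LV (ltW taus).
have E : eqH (fun x => u s x - u tau x) (V s).
  by apply: aeS2 (uV _ (ltW taus)) u0 => x + + xI => -> // -> //; rewrite subr0.
rewrite -(normH2_eqH E); apply: H; first exact: ltW.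
by rewrite ger0_norm; lra.
Qed.

(** The contraction only starts after [tau]; it is applied from a time s close to [tau], where both
    solutions are small by continuity. *)
Lemma lin_unique (b omega tau : R) (u z : R -> R -> R) :
  0 <= omega -> omega < pi ^+ 2 ->
  is_solution_lin b omega tau (fun _ => 0) u ->
  is_solution_lin b omega tau (fun _ => 0) z ->
  forall t, tau <= t -> eqH (u t) (z t).
Proof.
move=> om0 ompi su sz.
have rep (y : R -> R -> R) : is_solution_lin b omega tau (fun _ => 0) y ->
    exists V : R -> R -> R, forall t, tau <= t -> L2 (V t) /\ eqH (y t) (V t).
  move=> [yH _].
  have /choice[V HV] : forall t, exists g, tau <= t -> L2 g /\ eqH (y t) g.
    move=> t; have [tt|nt] := pselect (tau <= t); last by exists (fun _ => 0).
    by have [g Lg yg] := inH_L2 (yH t tt); exists g.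
  by exists V.
have [V HV] := rep u su; have [W HW] := rep z sz.
have V1 t : tau <= t -> eqH (u t) (V t) by case/HV.
have V2 t : tau <= t -> L2 (V t) by case/HV.
have W1 t : tau <= t -> eqH (z t) (W t) by case/HW.
have W2 t : tau <= t -> L2 (W t) by case/HW.
have [_ [cu [u0 _]]] := su; have [_ [cz [z0 _]]] := sz.
have lV : linflow b omega tau V.
  by apply: lin_linflow su => t /ltW; [exact: V1|exact: V2].
have lW : linflow b omega tau W.
  by apply: lin_linflow sz => t /ltW; [exact: W1|exact: W2].
move=> t; rewrite le_eqVlt => /orP[/eqP <-|taut].
  exact: eqH_trans u0 (eqH_sym z0).
have Lt := L2_sub (V2 _ (ltW taut)) (W2 _ (ltW taut)).
have N0 : normH (fun x => V t x - W t x) = 0.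
  apply/eqP; rewrite eq_le normH_ge0 andbT; apply/ler_addgt0Pr => e e0.
  rewrite add0r; have e20 : 0 < e / 2 by lra.
  have [d1 d10 H1] := continuousH_small V1 V2 cu u0 e20.
  have [d2 d20 H2] := continuousH_small W1 W2 cz z0 e20.
  pose s := tau + Num.min (t - tau) (Num.min d1 d2) / 2.
  have m0 : 0 < Num.min (t - tau) (Num.min d1 d2) by rewrite !lt_min d10 d20 subr_gt0 taut.
  have m1 : Num.min (t - tau) (Num.min d1 d2) <= t - tau by rewrite ge_min lexx.
  have m2 : Num.min (t - tau) (Num.min d1 d2) <= d1 by rewrite !ge_min lexx orbT.
  have m3 : Num.min (t - tau) (Num.min d1 d2) <= d2 by rewrite !ge_min lexx !orbT.
  have taus : tau < s by rewrite /s; lra.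
  have st : s <= t by rewrite /s; lra.
  have K1 := H1 s taus ltac:(rewrite /s; lra).
  have K2 := H2 s taus ltac:(rewrite /s; lra).
  have LVs := V2 _ (ltW taus); have LWs := L2_scale (-1) (W2 _ (ltW taus)).
  have Ls := L2_sub LVs (W2 _ (ltW taus)).
  have [mono _] := linflow_contraction om0 ompi lV lW taus st.
  have K3 : normH (fun x => V s x - W s x) <= e.
    have -> : (fun x => V s x - W s x) = (fun x => V s x + -1 * W s x).
      by apply/funext => x; rewrite mulN1r.
    rewrite (le_trans (normH_add LVs LWs))// normH_scale; last exact: W2 (ltW taus).
    by rewrite normrN1 mul1r; lra.
  apply: le_trans K3; rewrite -ler_sqr ?nnegrE ?normH_ge0//.
  by rewrite !normH_sqr.
have := normH0_eqH Lt; rewrite -normH_sqr// N0 expr0n => /(_ erefl) E.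
have E1 : eqH (V t) (W t).
  by apply: aeS E => x + xI => /(_ xI) /eqP; rewrite subr_eq0 => /eqP.
exact: eqH_trans (V1 _ (ltW taut)) (eqH_trans E1 (eqH_sym (W1 _ (ltW taut)))).
Qed.

Section Representative.
Variables (b omega : R) (phi U : R -> R -> R).
Hypothesis LU : forall t, L2 (U t).
Hypothesis phiU : forall t, eqH (phi t) (U t).

(** Going back in time, the squared distance to v grows at least linearly unless it is zero, which
    boundedness forbids. *)
Lemma ancient_trajectory_stationary (v : R -> R) :
  0 <= omega -> omega < pi ^+ 2 -> L2 v ->
  (forall tau, linflow b omega tau (fun _ => v)) ->
  (forall tau, linflow b omega tau U) -> boundedH phi ->
  forall t, eqH (phi t) v.
Proof.
move=> om0 ompi Lv lv lU [M HM] t.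
pose N (s : R) := ip (fun x => U s x - v x) (fun x => U s x - v x).
pose K := (M + normH v) ^+ 2.
have NK s : N s <= K.
  have LUv := L2_sub (LU s) Lv; have Lnv := L2_scale (-1) Lv.
  have Ms : normH (U s) <= M by rewrite -(normH_eqH (phiU s)).
  rewrite /N -normH_sqr// /K lerXn2r ?nnegrE ?normH_ge0//.
    by rewrite addr_ge0 ?normH_ge0// (le_trans _ Ms)// normH_ge0.
  have -> : (fun x => U s x - v x) = (fun x => U s x + -1 * v x).
    by apply/funext => x; rewrite mulN1r.
  rewrite (le_trans (normH_add (LU s) Lnv))// normH_scale// normrN1 mul1r.
  by rewrite lerD2r.
have k0 : 0 < pi ^+ 2 - omega by rewrite subr_gt0.
have Nt : N t = 0.
  apply/eqP; rewrite eq_le ip_ge0 andbT leNgt; apply/negP => Np.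
  have K0 : 0 <= K by exact: sqr_ge0.
  (* Far enough back for the contraction to read N t + K <= N s, whereas N s <= K. *)
  pose s := t - K / ((pi ^+ 2 - omega) * N t).
  have st : s <= t by rewrite /s gerBl divr_ge0// ltW// mulr_gt0.
  have s1 : s - 1 < s by lra.
  have [_] := linflow_contraction om0 ompi (lU (s - 1)) (lv (s - 1)) s1 st.
  rewrite -/(N t) -/(N s).
  have -> : N t * (1 + (pi ^+ 2 - omega) * (t - s)) = N t + K.
    have E (k n : R) : 0 < k -> 0 < n ->
        n * (1 + k * (t - (t - K / (k * n)))) = n + K.
      by move=> ? ?; field; rewrite !gt_eqF.
    by rewrite /s E.
  by have := NK s; lra.
have E := normH0_eqH (L2_sub (LU t) Lv) Nt.
apply: eqH_trans (phiU t) _.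
by apply: aeS E => x + xI => /(_ xI) /eqP; rewrite subr_eq0 => /eqP.
Qed.

Hypothesis traj : complete_trajectory_P b omega phi.

(** Continuity from the left at [tau], taken from the solution started at tau - 1. *)
Lemma trajectory_zero_closed (tau : R) :
  (forall t, t < tau -> eqH (phi t) (fun _ => 0)) -> eqH (phi tau) (fun _ => 0).
Proof.
move=> z; apply: eqH_trans (phiU tau) _; apply: normH0_eqH => //.
apply/eqP; rewrite eq_le ip_ge0 andbT; apply/ler_addgt0Pr => e e0; rewrite add0r.
have [_ [c _]] := traj (tau - 1).
have [d [d0 H]] := c tau ltac:(lra) e e0.
pose s := tau - Num.min d 1 / 2.
have m0 : 0 < Num.min d 1 by rewrite lt_min d0 ltr01.
have m1 : Num.min d 1 <= d by rewrite ge_min lexx.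
have m2 : Num.min d 1 <= 1 by rewrite ge_min lexx orbT.
have ss : s < tau by rewrite /s; lra.
have := H s ltac:(rewrite /s; lra) ltac:(rewrite ler0_norm /s; lra).
have E : eqH (fun x => phi s x - phi tau x) (fun x => -1 * U tau x).
  by apply: aeS2 (z s ss) (phiU tau) => x + + xI => -> // -> //; ring.
have Lm := L2_scale (-1) (LU tau).
rewrite (normH2_eqH E) normH2E// lte_fin ip_scalel// ip_scaler//.
by rewrite !mulN1r opprK => /ltW.
Qed.

Hypothesis om0 : 0 <= omega.
Hypothesis b0 : 0 < b.
Hypothesis U0 : forall t x, 0 <= U t x.

Lemma trajectory_superflow tau : superflow tau U.
Proof.
have [acU [r [_ rr Hr]]] :=
  solution_data (fun t _ => phiU t) (fun t _ => LU t) (traj tau).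
by apply: P_superflow rr Hr => //; move=> *; exact: phiU.
Qed.

(** No extinction: the mass present at [t0] is still seen at [t] by a bump about 1/2, of radius
    1/4. *)
Lemma trajectory_neq0_mono (t0 t : R) : t0 < t ->
  ~ eqH (phi t0) (fun _ => 0) -> ~ eqH (phi t) (fun _ => 0).
Proof.
move=> t0t n0 z.
have F0 : 0 < ip (U t0) (bump (1 / 4) (1 / 2)).
  apply: bump_pos_neq0 => // H; apply: n0; exact: eqH_trans (phiU t0) H.
have tau : t0 - 1 < t0 by lra.
have := superflow_spread (trajectory_superflow (t0 - 1)) tau t0t
  (e := 1 / 4) (x0 := 1 / 2) ltac:(lra) ltac:(lra) ltac:(lra) F0.
have Lb : L2 (bump ((1 / 4) ^+ 2) (1 / 2) : R -> R) by exact: prim_L2 (prim_bump _ _).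
rewrite (@ip_eqH _ (U t) (fun _ => 0) _ (bump ((1 / 4) ^+ 2) (1 / 2)))//.
- suff -> : ip (fun _ => 0) (bump ((1 / 4) ^+ 2) (1 / 2)) = 0 :> R by rewrite ltxx.
  rewrite -[RHS](mul0r (ip (fun _ => 0) (bump ((1 / 4) ^+ 2) (1 / 2)))) -ip_scalel//.
    by apply: eq_Rintegral => x _; rewrite !mul0r.
  exact: L2_cst.
- exact: L2_cst.
- exact: eqH_trans (eqH_sym (phiU t)) z.
- exact: aeW.
Qed.

Lemma trajectory_lin (tau : R) (u0 : R -> R) : eqH (phi tau) u0 ->
  (forall t, tau < t -> ~ eqH (phi t) (fun _ => 0)) ->
  is_solution_lin b omega tau u0 phi.
Proof.
move=> pu0 n0.
have [i1 [i2 [_ [i4 [r [Lr [rr Hr]]]]]]] := traj tau.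
split => //; split => //; split => //; split => //.
exists r; split => //; split => //.
have [_ _ _ sU] := trajectory_superflow tau.
apply: aeS2 sU rr => t Ht rt taut.
have [d [g [g1 [g2 [_ pg pg1 _ [Ug _]]]]]] := Ht taut.
(* Positivity at t needs a nonzero state strictly between [tau] and t. Once u(t) > 0 almost
   everywhere, H_0 is single-valued and the given r is already b + omega u. *)
pose t0 := (tau + t) / 2.
have taut0 : tau < t0 by rewrite /t0; lra.
have t0t : t0 < t by rewrite /t0; lra.
have F0 : 0 < ip (U t0) (bump (1 / 4) (1 / 2)).
  apply: bump_pos_neq0 => // H; apply: (n0 t0 taut0); exact: eqH_trans (phiU t0) H.
have gp := superflow_pos (trajectory_superflow tau) taut0 t0t F0 pg pg1 Ug.
have pg' := eqH_trans (phiU t) Ug.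
have pp : {ae mu, forall x : R, x \in I -> 0 < phi t x}.
  apply: aeS2 pg' (ae_interior R) => x K xint xI.
  by rewrite K//; apply: gp; exact: xint.
apply: aeS2 (rt taut) pp => x K1 K2 xI.
have ux := K2 xI; have [y [Hy ->]] := K1 xI.
case: Hy => [[]|[[]|[]]]; [lra|lra|].
by move=> _ ->; rewrite mulr1.
Qed.

End Representative.
End Trajectories.

Theorem theorem1 (R : realType) (b omega : R) (phi : R -> R -> R) :
  0 < b -> 0 <= omega -> omega < pi ^+ 2 ->
  complete_trajectory_P b omega phi ->
  boundedH phi -> nonnegH phi ->
  ~ (forall t, eqH (phi t) (fun _ => 0)) ->
  (forall v, is_v1plus b omega v -> ~ (forall t, eqH (phi t) v)) ->
  exists tau : R,
    (forall t, t <= tau -> eqH (phi t) (fun _ => 0)) /\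
    is_solution_lin b omega tau (fun _ => 0) phi /\
    (forall u, is_solution_lin b omega tau (fun _ => 0) u ->
       forall t, tau <= t -> eqH (u t) (phi t)).
Proof.
move=> b0 om0 ompi traj bphi phi0 nz nv.
have /choice[U HU] : forall t, exists g, [/\ L2 g, eqH (phi t) g & forall x, 0 <= g x].
  move=> t; have [iH _] := traj t; have [g Lg pg] := inH_L2 (iH t (lexx _)).
  (* Nonnegative everywhere, and still a representative because phi is nonnegative almost
     everywhere. *)
  exists (fun x => `|g x|); split => //.
    case: Lg => mg gi; split; first exact: measurableT_comp.
    by rewrite /normH2; under eq_integral do rewrite real_normK ?num_real//.
  by apply: aeS2 pg (phi0 t) => x + + xI => -> // /(_ xI) gx; rewrite ger0_norm.
have LU t : L2 (U t) by case: (HU t).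
have U0 t x : 0 <= U t x by case: (HU t).
have phiU t : eqH (phi t) (U t) by case: (HU t).
have mono := trajectory_neq0_mono LU phiU traj om0 b0 U0.
pose S := [set t | ~ eqH (phi t) (fun _ => 0)].
have S0 : S !=set0.
  apply: contrapT => nS; apply: nz => t; apply: contrapT => H.
  by apply: nS; exists t.
(* The infimum of the nonzero times is the instant at which the trajectory leaves 0; without a lower
   bound the trajectory is never 0. *)
have [[m Hm]|unb] := pselect (exists m, lbound S m).
  have iS : has_inf S by split => //; exists m.
  have z t : t < inf S -> eqH (phi t) (fun _ => 0).
    move=> tS; apply: contrapT => H.
    have : inf S <= t by apply: ge_inf => //; exists m.
    by rewrite leNgt tS.
  have z' := trajectory_zero_closed LU phiU traj z.
  have sol : is_solution_lin b omega (inf S) (fun _ => 0) phi.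
    apply: (trajectory_lin LU phiU traj om0 b0 U0) => // t St.
    have e0 : 0 < t - inf S by rewrite subr_gt0.
    have [t0 St0 t0t] := inf_adherent e0 iS.
    by apply: (mono t0 t) => //; move: t0t; rewrite addrC subrK.
  exists (inf S); split; last first.
    by split => // u su t St; exact: lin_unique om0 ompi su sol t St.
  by move=> t; rewrite le_eqVlt => /orP[/eqP ->|/z].
have nzt t : ~ eqH (phi t) (fun _ => 0).
  have [t0 St0 t0t] : exists2 t0, S t0 & t0 < t.
    apply: contrapT => H; apply: unb; exists t => t0 St0.
    by rewrite leNgt; apply/negP => t0t; apply: H; exists t0.
  exact: mono t0t St0.
have [v [vv [Lv lv]]] := v1plus_exists b0 om0 ompi.
have lU tau : linflow b omega tau U.
  apply: (@lin_linflow _ b omega tau (phi tau) phi U) => //.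
  apply: (trajectory_lin LU phiU traj om0 b0 U0) => //; exact: aeW.
by have := nv v vv (ancient_trajectory_stationary LU phiU om0 ompi Lv lv lU bphi).
Qed.
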